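(* Let $X$ be an FGC-SSRF on $\mathbb{R}^d$ ($d\ge1$) with a band-limited covariance spectral density (finite cutoff $k_c$) and permissible parameters. Then $X$ has differentiable sample paths with probability one: almost surely, the partial derivatives $\partial X(\mathbf{s})/\partial s_i$, $i=1,\dots,d$, of the sample path exist.
   Context: The fluctuation-gradient-curvature Spartan spatial random field (FGC-SSRF) on $\mathbb{R}^d$ with parameters $\eta_0>0$, $\eta_1\in\mathbb{R}$, $\xi>0$ and $0<k_c<\infty$ is the stationary, zero-mean Gaussian random field $X(\mathbf{s})$, $\mathbf{s}\in\mathbb{R}^d$, with covariance function $$G(\mathbf{r})=\frac{1}{(2\pi)^d}\int_{|\mathbf{k}|\le k_c}e^{i\mathbf{k}\cdot\mathbf{r}}\,\frac{\eta_0\,\xi^d}{1+\eta_1(|\mathbf{k}|\xi)^2+(|\mathbf{k}|\xi)^4}\,d\mathbf{k}$$ (band-limited spectral density, obtained with a boxcar coarse-graining kernel with cutoff $k_c$). The parameters are permissible if either $\eta_1>-2$, or $\eta_1<-2$ and $k_c\xi<\frac{1}{\sqrt2}\sqrt{|\eta_1|-\sqrt{\eta_1^2-4}}$. As usual, sample path properties are understood for a suitable version (modification) of the random field. *)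

(* Defs.v *)
From HB Require Import structures.
From mathcomp Require Import all_boot all_order all_algebra.
From mathcomp Require Import complex.
From mathcomp Require Import all_classical all_reals all_analysis.
Set Implicit Arguments.
Unset Strict Implicit.
Unset Printing Implicit Defensive.
Import Order.TTheory GRing.Theory Num.Theory.
Import numFieldNormedType.Exports.
Local Open Scope classical_set_scope.
Local Open Scope ring_scope.

Section cons_lebesgue.
Context (R : realType) (n : nat).

Definition tcons (p : R * n.-tuple R) : n.+1.-tuple R :=
  [tuple of p.1 :: p.2].

Lemma measurable_tcons : measurable_fun [set: R * n.-tuple R] tcons.
Proof. exact: measurable_cons measurable_fst measurable_snd. Qed.

Variable mu : {sigma_finite_measure set (n.-tuple R) -> \bar R}.

Definition cons_measure : set (n.+1.-tuple R) -> \bar R :=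
  pushforward ((@lebesgue_measure R) \x mu)%E tcons.

Let cons_measure0 : cons_measure set0 = 0%E.
Proof. by rewrite /cons_measure /pushforward preimage_set0 measure0. Qed.

Let cons_measure_ge0 A : (0 <= cons_measure A)%E.
Proof. by rewrite /cons_measure /pushforward measure_ge0. Qed.

Let cons_measure_sigma_additive : semi_sigma_additive cons_measure.
Proof.
have mpre A : measurable A -> measurable (tcons @^-1` A).
  by move=> mA; rewrite -[X in measurable X]setTI; exact: measurable_tcons.
move=> F mF tF mUF; rewrite /cons_measure /pushforward preimage_bigcup.
apply: measure_semi_sigma_additive.
- by move=> k; apply: mpre.
- apply/trivIsetP => /= i j _ _ ij; rewrite -preimage_setI.
  by move/trivIsetP : tF => /(_ _ _ _ _ ij) ->//; rewrite preimage_set0.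
- by rewrite -preimage_bigcup; exact: mpre.
Qed.

HB.instance Definition _ := isMeasure.Build _ _ _ cons_measure
  cons_measure0 cons_measure_ge0 cons_measure_sigma_additive.

Lemma cons_measure_sigma_finite : sigma_finite setT cons_measure.
Proof.
have /sigma_finiteP[F [TF ndF Foo]] := sigma_finiteT (@lebesgue_measure R).
have /sigma_finiteP[G [TG ndG Goo]] := sigma_finiteT mu.
pose H k : set (n.+1.-tuple R) :=
  [set v | F k (thead v) /\ G k [tuple of behead v]].
exists H.
  apply/esym/seteqP; split => // v _.
  have [i _ Fi] : (\bigcup_k F k) (thead v) by rewrite -TF.
  have [j _ Gj] : (\bigcup_k G k) [tuple of behead v] by rewrite -TG.
  exists (maxn i j) => //; split.
  - by move: Fi; exact/subsetPset/ndF/leq_maxl.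
  - by move: Gj; exact/subsetPset/ndG/leq_maxr.
move=> k; have [mF Fk] := Foo k; have [mG Gk] := Goo k; split.
  apply: measurableI.
  - by rewrite -[X in measurable X]setTI; apply: (measurable_tnth ord0).
  - by rewrite -[X in measurable X]setTI; apply: measurable_behead.
rewrite /cons_measure /pushforward (_ : _ @^-1` _ = F k `*` G k).
  by rewrite product_measure1E// lte_mul_pinfty// ge0_fin_numE.
apply/seteqP; split => -[x v] /=; rewrite /H/= theadE.
  move=> [Fx Gv]; split => //=.
  by rewrite (_ : v = [tuple of behead (tcons (x, v))])//; exact: val_inj.
move=> [Fx Gv]; split => //.
by rewrite (_ : [tuple of _] = v)//; exact: val_inj.
Qed.

HB.instance Definition _ :=
  Measure_isSigmaFinite.Build _ _ _ cons_measure cons_measure_sigma_finite.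

End cons_lebesgue.

(* Lebesgue measure on R^d, as the d-fold product of the one-dimensional
   Lebesgue measure; R^0 is a point of mass 1. *)
Fixpoint lebesgue_tuple (R : realType) (d : nat) :
    {sigma_finite_measure set (d.-tuple R) -> \bar R} :=
  match d with
  | 0%N => \d_([tuple] : 0.-tuple R)
  | n.+1 => cons_measure (lebesgue_tuple R n)
  end.

Section spartan.
Context (R : realType) (d : nat).

(* Explicitly Euclidean: the library norm on row vectors is the max norm. *)
Definition euclidean_norm (k : d.-tuple R) : R :=
  Num.sqrt (\sum_(i < d) tnth k i ^+ 2).

Definition dotp (k : d.-tuple R) (r : 'rV[R]_d) : R :=
  \sum_(i < d) tnth k i * r 0 i.

Definition expi (x : R) : R[i] := (cos x +i* sin x)%C.

Definition Cintegral (D : set (d.-tuple R)) (f : d.-tuple R -> R[i]) : R[i] :=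
  ((\int[lebesgue_tuple R d]_(k in D) complex.Re (f k)) +i*
   (\int[lebesgue_tuple R d]_(k in D) complex.Im (f k)))%C.

Definition spectral_density (eta0 eta1 xi : R) (k : d.-tuple R) : R :=
  eta0 * xi ^+ d /
  (1 + eta1 * (euclidean_norm k * xi) ^+ 2 + (euclidean_norm k * xi) ^+ 4).

Definition fgc_covariance (eta0 eta1 xi kc : R) (r : 'rV[R]_d) : R[i] :=
  (((2 * pi) ^+ d)^-1)%:C%C *
  Cintegral [set k | euclidean_norm k <= kc]
    (fun k => expi (dotp k r) * (spectral_density eta0 eta1 xi k)%:C%C).

Definition permissible (eta1 xi kc : R) : Prop :=
  - 2 < eta1 \/
  eta1 < - 2 /\
    kc * xi <
      (Num.sqrt 2)^-1 * Num.sqrt (`|eta1| - Num.sqrt (eta1 ^+ 2 - 4)).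

End spartan.

Section random_field.
Context (disp : measure_display) (T : measurableType disp) (R : realType)
  (P : probability T R).

(* The degenerate case is separate: the library's normal_prob m 0 is not a
   point mass but the uniform law on [0, 1]. *)
Definition gaussian_rv (Z : T -> R) : Prop :=
  exists m sigma : R, forall A : set R, measurable A ->
    P (Z @^-1` A) = if sigma == 0 then \d_m A else normal_prob m sigma A.

Definition gaussian_field (d : nat) (X : 'rV[R]_d -> {RV P >-> R}) : Prop :=
  forall (n : nat) (s : 'I_n -> 'rV[R]_d) (a : 'I_n -> R),
    gaussian_rv (fun w => \sum_(i < n) a i * X (s i) w).

(* Stationarity is the independence of the covariance from s in the last
   field (together with the constant mean). *)
Record FGC_SSRF (d : nat) (eta0 eta1 xi kc : R)
    (X : 'rV[R]_d -> {RV P >-> R}) : Prop := {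
  FGC_SSRF_gaussian : gaussian_field X ;
  FGC_SSRF_mean : forall s, ('E_P[X s] = 0)%E ;
  FGC_SSRF_covariance : forall s r, exists2 c : R,
    covariance P (X (s + r)) (X s) = c%:E &
    c%:C%C = fgc_covariance eta0 eta1 xi kc r }.

Definition modification (d : nat) (Y X : 'rV[R]_d -> {RV P >-> R}) : Prop :=
  forall s, {ae P, forall w, Y s w = X s w}.

End random_field.

(* Main.v *)
(* The spectrum of X lies in the ball |k| <= kc. With the mesh h = 1 / (64 kc), the number
   z_i = e^{i h k_i} - 1 has modulus at most 1/32 on that ball, so that Newton's series
   e^{i t h k_i} = \sum_j (t choose j) z_i^j converges there, uniformly in k. By the
   spectral isometry X(s) is, in mean square, the sum of the Newton series
   \sum_al \prod_i (s_i / h choose al_i) D^al X(0) over multi-indices al, where D^al is the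
   iterated forward difference of step h, and E (D^al X(0))^2 <= 1024^{-|al|} E X(0)^2.
   Hence almost surely D^al X(0) = O(8^{-|al|}). As the binomial coefficients and their
   difference quotients are O(4^{|al|}), the series then converges for every s to a function
   that has partial derivatives everywhere; by Fatou's lemma it equals X(s) almost surely. *)
Require Import Defs.
From mathcomp Require Import all_boot all_order all_algebra.
From mathcomp Require Import complex ring lra.
From mathcomp Require Import all_classical all_reals all_analysis.
From mathcomp Require Import measurable_realfun.
Import Order.TTheory GRing.Theory Num.Theory.
Import numFieldNormedType.Exports.
Import ComplexField Normc.
Local Open Scope classical_set_scope.
Local Open Scope ring_scope.

Set Implicit Arguments.
Unset Strict Implicit.
Unset Printing Implicit Defensive.

(** * Generalized binomial coefficients, their difference quotients, and growth bounds *)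

Section newton_binomial.
Context {R : realType}.
Implicit Types (t u : R) (m T : nat).

(* The binomial coefficient "t choose m" for real t. *)
Definition nbin t m : R := \prod_(j < m) ((t - j%:R) / j.+1%:R).

(* Difference quotient of [nbin ^~ m] between t and t + u, see [nbinD]; unlike a
   quotient it is defined and continuous at u = 0. *)
Fixpoint dnbin t u m : R :=
  if m is j.+1 then
    (dnbin t u j * (t - j%:R) + nbin (t + u) j) / j.+1%:R
  else 0.

Lemma nbin0 t : nbin t 0 = 1.
Proof. by rewrite /nbin big_ord0. Qed.

Lemma nbinS t m : nbin t m.+1 = nbin t m * ((t - m%:R) / m.+1%:R).
Proof. by rewrite /nbin big_ord_recr. Qed.

Lemma nbinD t u m : nbin (t + u) m = nbin t m + u * dnbin t u m.
Proof.
elim: m => [|m IH] /=; first by rewrite !nbin0 mulr0 addr0.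
rewrite !nbinS !mulrA -mulrDl; congr (_ / _).
by rewrite {1}IH IH; ring.
Qed.

Lemma bin_le_exp2 n m : ('C(n, m) <= 2 ^ n)%N.
Proof.
elim: n m => [|n IH] [|m] //=; first by rewrite bin0 expn_gt0.
by rewrite binS expnS mul2n -addnn leq_add.
Qed.

(** The majorant ['C(T + m, m)] obeys a one-factor recursion parallel to [nbinS], so that bounds
    pass from m to m + 1 factor by factor. *)
Lemma bin_quot T m :
  'C(T + m.+1, m.+1)%:R = 'C(T + m, m)%:R * ((T + m.+1)%:R / m.+1%:R) :> R.
Proof.
rewrite mulrA; apply: canRL (mulfK _) _; first by rewrite pnatr_eq0.
by rewrite -!natrM mulnC -mul_bin_diag addnS mulnC.
Qed.

Lemma norm_factor_le T t m : `|t| <= T.+1%:R ->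
  `|(t - m%:R) / m.+1%:R| <= (T + m.+1)%:R / m.+1%:R.
Proof.
move=> tT; rewrite normrM (ger0_norm (_ : 0 <= m.+1%:R^-1)) ?invr_ge0//.
rewrite ler_pM2r ?invr_gt0 ?ltr0n//.
rewrite (le_trans (ler_normB _ _))// (normr_nat _ m) -addSnnS natrD lerD2r.
exact: tT.
Qed.

(** The extreme case is t = -(T + 1), where all factors have the same sign and equality holds. *)
Lemma norm_nbin_le_bin T t m : `|t| <= T.+1%:R -> `|nbin t m| <= 'C(T + m, m)%:R.
Proof.
move=> tT; elim: m => [|m IH]; first by rewrite nbin0 bin0 normr1.
by rewrite nbinS normrM bin_quot ler_pM// norm_factor_le.
Qed.

Lemma norm_nbin_le T t m : `|t| <= T.+1%:R -> `|nbin t m| <= 2 ^+ T * 2 ^+ m.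
Proof.
move=> /(@norm_nbin_le_bin _ _ m)/le_trans; apply.
by rewrite -exprD -natrX ler_nat bin_le_exp2.
Qed.

Lemma norm_dnbin_le T t u m : `|t| <= T.+1%:R -> `|t + u| <= T.+1%:R ->
  `|dnbin t u m| <= 2 ^+ T * 4 ^+ m.
Proof.
move=> tT tuT.
(* As in a product rule, there is one summand per factor of [nbin], each at most the majorant of
   [nbin] itself. The extra m is then absorbed by m <= 2^m, whence 4^m. *)
suff H : `|dnbin t u m| <= m%:R * 'C(T + m, m)%:R.
  rewrite (le_trans H)// mulrC -natrX -natrX -!natrM ler_nat.
  rewrite (_ : 4 = 2 * 2)%N// expnMn mulnA leq_mul// ?(ltnW (ltn_expl _ _))//.
  by rewrite -expnD bin_le_exp2.
elim: m => [|m IH]; first by rewrite /= normr0 mul0r.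
rewrite /= mulrDl -mulrA (le_trans (ler_normD _ _))// bin_quot.
rewrite -[X in _ <= X * _]natr1 [leRHS]mulrDl mul1r [X in _ <= X + _]mulrA; apply: lerD.
  by rewrite normrM ler_pM// norm_factor_le.
rewrite normrM ler_pM ?norm_nbin_le_bin//.
rewrite ger0_norm ?invr_ge0// -[leLHS]mul1r ler_pM2r ?invr_gt0 ?ltr0n//.
by rewrite addnS (ler_nat _ 1).
Qed.

Lemma continuous_nbin m : continuous (nbin ^~ m).
Proof.
elim: m => [|m IH] t.
  by rewrite (_ : nbin ^~ 0%N = cst 1); [exact: cvg_cst|apply/funext => x; rewrite nbin0].
rewrite (_ : nbin ^~ m.+1 = fun t => nbin t m * ((t - m%:R) / m.+1%:R)).
  apply: cvgM; first exact: IH.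
  by apply: cvgM; [apply: cvgB; [exact: cvg_id|exact: cvg_cst]|exact: cvg_cst].
by apply/funext => x; rewrite nbinS.
Qed.

Lemma continuous_dnbin t m : continuous (fun u => dnbin t u m).
Proof.
elim: m => [|m IH] u /=; first exact: cvg_cst.
apply: cvgM; last exact: cvg_cst.
apply: cvgD; first by apply: cvgM; [exact: IH|exact: cvg_cst].
apply: (@continuous_comp _ _ _ (fun u => t + u) (nbin ^~ m)).
  by apply: cvgD; [exact: cvg_cst|exact: cvg_id].
exact: continuous_nbin.
Qed.

End newton_binomial.

(** * Real-valued modulus on R[i] and the character e^{ix} *)

Section complex_modulus.
Context {R : realType}.
Implicit Types (x y : R) (z : R[i]).

Lemma normc_ge0 z : 0 <= normc z.
Proof. by case: z => a b; exact: sqrtr_ge0. Qed.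

Lemma sqr_normcE z : normc z ^+ 2 = complex.Re z ^+ 2 + complex.Im z ^+ 2.
Proof. by case: z => a b; rewrite sqr_sqrtr// addr_ge0 ?sqr_ge0. Qed.

Lemma normc_leD z : normc z <= `|complex.Re z| + `|complex.Im z|.
Proof.
rewrite -(@ler_pXn2r _ 2)// ?nnegrE ?normc_ge0 ?addr_ge0//.
rewrite sqr_normcE sqrrD !real_normK ?num_real// addrAC.
by rewrite lerDl mulrn_wge0 ?mulr_ge0.
Qed.

Lemma le_normc_Re z : `|complex.Re z| <= normc z.
Proof.
rewrite -(@ler_pXn2r _ 2)// ?nnegrE ?normc_ge0// sqr_normcE -normrX.
by rewrite ger0_norm ?sqr_ge0// lerDl sqr_ge0.
Qed.

Lemma le_normc_Im z : `|complex.Im z| <= normc z.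
Proof.
rewrite -(@ler_pXn2r _ 2)// ?nnegrE ?normc_ge0// sqr_normcE -normrX.
by rewrite ger0_norm ?sqr_ge0// lerDr sqr_ge0.
Qed.

Lemma normc_real x : normc x%:C%C = `|x|.
Proof. by rewrite /normc/= expr0n addr0 sqrtr_sqr. Qed.

Lemma normcX z n : normc (z ^+ n) = normc z ^+ n.
Proof. by elim: n => [|n IH]; rewrite ?normc1// !exprS normcM IH. Qed.

Lemma normc_prod (I : finType) (F : I -> R[i]) :
  normc (\prod_i F i) = \prod_i normc (F i).
Proof. by apply: big_morph; [exact: normcM|exact: normc1]. Qed.

Lemma normcB z1 z2 : normc (z1 - z2) = normc (z2 - z1).
Proof. by rewrite -[RHS]normcN opprB. Qed.

Lemma normc_expi x : normc (expi x) = 1.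
Proof. by rewrite /normc/= cos2Dsin2 sqrtr1. Qed.

Lemma expi0 : expi (0 : R) = 1.
Proof. by rewrite /expi cos0 sin0. Qed.

Lemma expiD x y : expi (x + y) = expi x * expi y.
Proof.
by rewrite /expi cosD sinD; apply/eqP; rewrite eq_complex /= eqxx addrC eqxx.
Qed.

Lemma expi_sum (I : finType) (F : I -> R) :
  expi (\sum_i F i) = \prod_i expi (F i).
Proof. by apply: big_morph; [exact: expiD|exact: expi0]. Qed.

End complex_modulus.

(** * Derivatives of complex functions of a real variable *)

Section complex_derivative.
Context {R : realType}.
Implicit Types (x : R) (f g : R -> R[i]).

Definition is_cderive x f (df : R[i]) : Prop :=
  is_derive x 1 (@complex.Re R \o f) (complex.Re df) /\
  is_derive x 1 (@complex.Im R \o f) (complex.Im df).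

Lemma is_cderive_eq x f (df df' : R[i]) :
  is_cderive x f df -> df = df' -> is_cderive x f df'.
Proof. by move=> ? <-. Qed.

Lemma is_cderive_cst x (c : R[i]) : is_cderive x (cst c) 0.
Proof. by split; exact: is_derive_cst. Qed.

Lemma is_cderiveD x f g df dg :
  is_cderive x f df -> is_cderive x g dg ->
  is_cderive x (fun y => f y + g y) (df + dg).
Proof.
move=> [f1 f2] [g1 g2]; split.
- have := is_deriveD f1 g1; rewrite (_ : _ \o _ + _ = @complex.Re R \o (fun y => f y + g y)).
    by move=> /is_derive_eq; apply; case: (df); case: (dg).
  by apply/funext => y; rewrite !fctE/=; case: (f y) => ? ?; case: (g y).
- have := is_deriveD f2 g2; rewrite (_ : _ \o _ + _ = @complex.Im R \o (fun y => f y + g y)).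
    by move=> /is_derive_eq; apply; case: (df); case: (dg).
  by apply/funext => y; rewrite !fctE/=; case: (f y) => ? ?; case: (g y).
Qed.

Lemma is_cderiveM x f g df dg :
  is_cderive x f df -> is_cderive x g dg ->
  is_cderive x (fun y => f y * g y) (df * g x + f x * dg).
Proof.
move=> [f1 f2] [g1 g2]; split.
- have := is_deriveB (is_deriveM f1 g1) (is_deriveM f2 g2).
  rewrite (_ : _ - _ = @complex.Re R \o (fun y => f y * g y)).
    move=> /is_derive_eq; apply; rewrite /= /GRing.scale/=.
    by case: (df); case: (dg); case: (f x); case: (g x) => * /=; ring.
  by apply/funext => y /=; rewrite !fctE/=; case: (f y) => ? ?; case: (g y).
- have := is_deriveD (is_deriveM f1 g2) (is_deriveM f2 g1).
  rewrite (_ : _ + _ = @complex.Im R \o (fun y => f y * g y)).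
    move=> /is_derive_eq; apply; rewrite /= /GRing.scale/=.
    by case: (df); case: (dg); case: (f x); case: (g x) => * /=; ring.
  by apply/funext => y /=; rewrite !fctE/=; case: (f y) => ? ?; case: (g y).
Qed.

Lemma is_cderive_expi x (c : R) :
  is_cderive x (fun y => expi (y * c)) ('i%C * c%:C%C * expi (x * c)).
Proof.
have dc : is_derive x 1 (fun y : R => y * c) c.
  have := is_deriveZ c (is_derive_id x (1 : R)).
  rewrite (_ : c \*: id = fun y : R => y * c); last by apply/funext => y; rewrite /= mulrC.
  by move/is_derive_eq; apply; rewrite /GRing.scale/= mulr1.
split.
- have := @is_derive1_comp R (@cos R) (fun y => y * c) x _ _ (is_derive_cos _) dc.
  by move=> /is_derive_eq; apply; rewrite /=; ring.
- have := @is_derive1_comp R (@sin R) (fun y => y * c) x _ _ (is_derive_sin _) dc.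
  by move=> /is_derive_eq; apply; rewrite /=; ring.
Qed.

Lemma is_cderiveX x f df n : is_cderive x f df ->
  is_cderive x (fun y => f y ^+ n.+1) (n.+1%:R * df * f x ^+ n).
Proof.
move=> fdf; elim: n => [|n IH].
  apply: (is_cderive_eq (df := df)); last by rewrite mul1r expr0 mulr1.
  by rewrite (_ : (fun y => f y ^+ 1) = f)//; apply/funext => y; rewrite expr1.
rewrite (_ : (fun y => f y ^+ n.+2) = fun y => f y * f y ^+ n.+1).
  apply: is_cderive_eq; first exact: (is_cderiveM fdf IH).
  by rewrite -[in RHS]natr1 exprS; ring.
by apply/funext => y; rewrite exprS.
Qed.

(** The mean value theorem has no equality form for complex values; it is applied to the real and
    imaginary parts separately, which costs the factor 2. *)
Lemma normc_mean_value f (df : R -> R[i]) D y :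
  (forall x, is_cderive x f (df x)) ->
  (forall x, `|x| <= `|y| -> normc (df x) <= D) ->
  normc (f y - f 0) <= 2 * `|y| * D.
Proof.
move=> fdf dfD.
have H (h dh : R -> R) : (forall x, is_derive x 1 h (dh x)) ->
    (forall x, `|dh x| <= normc (df x)) -> `|h y - h 0| <= `|y| * D.
  move=> hdh hD.
  have ch a b : {within `[a, b], continuous h}.
    apply: continuous_subspaceT => x; apply: differentiable_continuous.
    by apply/derivable1_diffP; apply: ex_derive; exact: hdh.
  have [y0|/ltW y0] := leP 0 y.
    have [c + ->] := MVT_segment y0 (fun x _ => hdh x) (ch _ _).
    rewrite in_itv/= => /andP[c0 cy]; rewrite subr0 normrM mulrC ler_wpM2l//.
    by rewrite (le_trans (hD _))// dfD// !ger0_norm.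
  rewrite distrC.
  have [c + ->] := MVT_segment y0 (fun x _ => hdh x) (ch _ _).
  rewrite in_itv/= => /andP[c0 cy]; rewrite sub0r normrM normrN mulrC ler_wpM2l//.
  by rewrite (le_trans (hD _))// dfD// !ler0_norm// lerN2.
rewrite (le_trans (normc_leD _))// -mulrA mulr_natl mulr2n; apply: lerD.
- have := H (@complex.Re R \o f) _ (fun x => (fdf x).1) (fun x => le_normc_Re _).
  by rewrite /=; case: (f y); case: (f 0).
- have := H (@complex.Im R \o f) _ (fun x => (fdf x).2) (fun x => le_normc_Im _).
  by rewrite /=; case: (f y); case: (f 0).
Qed.

End complex_derivative.

(** * Newton's expansion of e^{itx} in powers of e^{ix} - 1 *)

Section newton_expansion.
Context {R : realType}.
Implicit Types (t x : R) (N T : nat).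

Definition newton_sum t N (z : R[i]) : R[i] :=
  \sum_(j < N) (nbin t j)%:C%C * z ^+ j.

(* By [nbinS] the derivative telescopes to its last term. *)
Lemma is_cderive_newton_sum t N x :
  is_cderive x (fun y => expi (y * - t) * newton_sum t N.+1 (expi y - 1))
    (- 'i%C * expi (x * - t) * ((t - N%:R) * nbin t N)%:C%C * (expi x - 1) ^+ N).
Proof.
have dz : is_cderive x (fun y => expi y - 1) ('i%C * expi x).
  have := is_cderiveD (is_cderive_expi x 1) (is_cderive_cst x (-1)).
  rewrite (_ : (fun y => _ + _) = fun y => expi y - 1); last by apply/funext => y; rewrite mulr1.
  by move=> /is_cderive_eq; apply; rewrite mulr1 addr0 mulr1.
have de := is_cderive_expi x (- t).
elim: N => [|N IH].
  have -> : (fun y => expi (y * - t) * newton_sum t 1 (expi y - 1)) = (fun y => expi (y * - t)).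
    by apply/funext => y; rewrite /newton_sum big_ord1 nbin0 expr0 !mulr1.
  by apply: (is_cderive_eq de); rewrite nbin0 subr0 expr0 !mulr1 rmorphN; ring.
have -> : (fun y => expi (y * - t) * newton_sum t N.+2 (expi y - 1)) =
  (fun y => expi (y * - t) * newton_sum t N.+1 (expi y - 1) +
    expi (y * - t) * ((nbin t N.+1)%:C%C * (expi y - 1) ^+ N.+1)).
  by apply/funext => y; rewrite /newton_sum [in LHS]big_ord_recr/= mulrDr.
apply: is_cderive_eq; first apply: (is_cderiveD IH).
  apply: (is_cderiveM de).
  apply: (is_cderiveM (is_cderive_cst x _)).
  exact: (is_cderiveX _ dz).
(* With z = e^{ix} - 1, the derivative of z is i (1 + z). In this form the remainder at rank N
   cancels the z^N part of the derivative of the new term; only z^{N+1} survives. *)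
have -> : (t - N%:R) * nbin t N = N.+1%:R * nbin t N.+1.
  by rewrite nbinS mulrCA mulrC; congr (_ * _); rewrite mulrC divfK// pnatr_eq0.
rewrite /cst -[(nbin t N.+1 +i* 0)%C]/((nbin t N.+1)%:C)%C exprS.
rewrite !rmorphM !rmorphB !rmorph_nat rmorphN.
by move: ((expi x - 1) ^+ N) (expi x) (expi (x * - t)) => u v w; ring.
Qed.

Lemma normc_expi_sub1 x : normc (expi x - 1) <= 2 * `|x|.
Proof.
rewrite -[X in _ - X]expi0 -[leRHS]mulr1.
apply: (normc_mean_value (df := fun y => 'i%C * expi y)).
  move=> y; have := is_cderive_expi y 1.
  rewrite (_ : (fun y => _) = @expi R); last by apply/funext => u; rewrite mulr1.
  by move=> /is_cderive_eq; apply; rewrite !mulr1.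
by move=> y _; rewrite normcM normc_expi mulr1 /normc/= expr0n expr1n add0r sqrtr1.
Qed.

(** Up to a factor of modulus 1, the error is 1 - e^{-itx} S(x) with S the Newton sum, and the
    derivative of e^{-itx} S(x) is a single term. There |t - N| and |[nbin t N]| grow at most like
    2^N each, while |z|^N <= 32^{-N}; this leaves 8^{-N}. *)
Lemma newton_sum_error T t N x : `|t| <= T.+1%:R -> `|x| <= 64^-1 ->
  normc (expi (t * x) - newton_sum t N.+1 (expi x - 1)) <=
    T.+1%:R * 2 ^+ T * 8^-1 ^+ N.
Proof.
move=> tT x64; set P := newton_sum _ _ _; set D := leRHS.
have D0 : 0 <= D by rewrite /D !mulr_ge0// exprn_ge0.
have -> : expi (t * x) - P = expi (x * t) * (1 - expi (x * - t) * P).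
  rewrite mulrBr mulrA -expiD mulrN subrr expi0 mul1r mulr1.
  by rewrite mulrC.
rewrite normcM normc_expi mul1r normcB.
(* The constant 1 is the value of e^{-itx} S(x) at x = 0, so the mean value estimate applies. *)
have -> : 1 = expi (0 * - t) * newton_sum t N.+1 (expi (0 : R) - 1).
  rewrite mul0r expi0 mul1r subrr /newton_sum big_ord_recl nbin0 expr0 mulr1.
  by rewrite big1 ?addr0// => i _; rewrite exprS mul0r mulr0.
apply: le_trans (_ : 2 * `|x| * D <= _); last first.
  by rewrite -[leRHS]mul1r ler_wpM2r//; lra.
apply: (normc_mean_value (fun y => is_cderive_newton_sum t N y)) => y yx.
rewrite !normcM normc_expi normcX normc_real normrM mulr1.
rewrite normcN (_ : normc 'i%C = 1) ?mul1r; last first.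
  by rewrite /normc/= expr0n expr1n add0r sqrtr1.
have z32 : normc (expi y - 1) ^+ N <= 32^-1 ^+ N.
  rewrite lerXn2r ?nnegrE ?normc_ge0 ?invr_ge0//.
  by rewrite (le_trans (normc_expi_sub1 _))//; lra.
have tN : `|t - N%:R| <= T.+1%:R * 2 ^+ N.
  rewrite (le_trans (ler_normB _ _))// (le_trans (lerD tT (lexx _)))//.
  rewrite normr_nat -natrD -natrX -natrM ler_nat.
  rewrite (@leq_trans (T.+1 * N.+1))//; first by rewrite mulnS leq_add2l leq_pmull.
  by rewrite leq_mul// ltn_expl.
apply: le_trans (_ : T.+1%:R * 2 ^+ N * (2 ^+ T * 2 ^+ N) * 32^-1 ^+ N <= _).
  by rewrite ler_pM// ?mulr_ge0// ?exprn_ge0 ?normc_ge0// ler_pM// norm_nbin_le.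
rewrite /D le_eqVlt; apply/orP; left; apply/eqP.
have -> : (8^-1 : R) ^+ N = 2 ^+ N * 2 ^+ N * 32^-1 ^+ N.
  by rewrite -!exprMn; congr (_ ^+ _); lra.
by ring.
Qed.

End newton_expansion.

(** * Limits of finite sums and products *)

Section finite_limits.
Context {R : realType} {T : Type} {F : set_system T} {FF : Filter F} {I : finType}.
Implicit Types (f : I -> T -> R) (l : I -> R).

Lemma cvg_sumr f l : (forall i, f i x @[x --> F] --> l i) ->
  \sum_i f i x @[x --> F] --> \sum_i l i.
Proof.
move=> fl; apply: (@cvg_big R I +%R 0 predT _ T F (index_enum I) f l) => //.
exact: add_continuous.
Qed.

Lemma cvg_prodr f l : (forall i, f i x @[x --> F] --> l i) ->
  \prod_i f i x @[x --> F] --> \prod_i l i.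
Proof.
move=> fl; apply: (@cvg_big R I *%R 1 predT _ T F (index_enum I) f l) => //.
exact: mul_continuous.
Qed.

End finite_limits.

(** * Multi-indexed series, summed over growing cubes *)

Section box_sums.
Context {R : realType} {d : nat}.
Implicit Types (al : 'I_d -> nat).

(** Cubes are preferred to simplices |al| <= N because a sum of products over a cube factors into
    one-dimensional sums. *)
Definition box_sum {V : zmodType} N (F : ('I_d -> nat) -> V) : V :=
  \sum_(f : {ffun 'I_d -> 'I_N.+1}) F (fun i => f i).

(** This is x^|al|, in the product form that [box_sum_prod] expects. *)
Definition mpow (x : R) al : R := \prod_i x ^+ al i.

Lemma mpow_ge0 x al : 0 <= x -> 0 <= mpow x al.
Proof. by move=> x0; apply: prodr_ge0 => i _; rewrite exprn_ge0. Qed.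

Lemma mpowM x y al : mpow (x * y) al = mpow x al * mpow y al.
Proof. by rewrite /mpow -big_split; apply: eq_bigr => i _; rewrite exprMn. Qed.

Lemma box_sumB {V : zmodType} N M (F : ('I_d -> nat) -> V) : (N <= M)%N ->
  box_sum M F - box_sum N F =
  \sum_(f : {ffun 'I_d -> 'I_M.+1} | ~~ [forall i, f i <= N]%N) F (fun i => f i).
Proof.
move=> NM; rewrite /box_sum.
rewrite (bigID (fun f : {ffun 'I_d -> 'I_M.+1} => [forall i, f i <= N]%N))/=.
have le : (N.+1 <= M.+1)%N by [].
(* The indices of the large cube with all entries at most N are exactly the widened indices of the
   small cube; [inord] is the inverse map. *)
rewrite (reindex_onto (fun f : {ffun 'I_d -> 'I_N.+1} => [ffun i => widen_ord le (f i)])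
  (fun f : {ffun 'I_d -> 'I_M.+1} => [ffun i => inord (f i)])) /=; last first.
  move=> f /forallP fN; apply/ffunP => i; rewrite !ffunE; apply/val_inj => /=.
  by rewrite inordK// ltnS.
rewrite [X in X + _ - _](_ : _ = \sum_(f : {ffun 'I_d -> 'I_N.+1}) F (fun i => f i)).
  by rewrite addrC addKr.
apply: eq_big => [f|f _].
  apply/andP; split.
    by apply/forallP => i; rewrite ffunE/= -ltnS.
  by apply/eqP/ffunP => i; rewrite !ffunE/=; apply/val_inj; rewrite /= inordK.
by congr F; apply/funext => i; rewrite ffunE.
Qed.

Lemma box_sum_prod {V : comNzRingType} N (g : 'I_d -> nat -> V) :
  box_sum N (fun al => \prod_i g i (al i)) = \prod_i \sum_(j < N.+1) g i j.
Proof.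
by rewrite (bigA_distr_bigA (fun i (j : 'I_N.+1) => g i j)).
Qed.

Lemma box_sumZ N (K : R) (F : ('I_d -> nat) -> R) :
  box_sum N (fun al => K * F al) = K * box_sum N F.
Proof. by rewrite /box_sum mulr_sumr. Qed.

Lemma le_box_sum N (F G : ('I_d -> nat) -> R) :
  (forall al, F al <= G al) -> box_sum N F <= box_sum N G.
Proof. by move=> FG; apply: ler_sum => f _. Qed.

Lemma nondecreasing_box_sum (F : ('I_d -> nat) -> R) : (forall al, 0 <= F al) ->
  {homo (fun N => box_sum N F) : N M / (N <= M)%N >-> N <= M}.
Proof.
by move=> F0 N M NM; rewrite -subr_ge0 box_sumB//; apply: sumr_ge0 => f _.
Qed.

(** The total degree |al| bounds every entry of al, so the cube of that size contains al. *)
Lemma box_sum_ge (F : ('I_d -> nat) -> R) al : (forall al, 0 <= F al) ->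
  F al <= box_sum (\sum_i al i) F.
Proof.
move=> F0; rewrite /box_sum.
have ale i : (al i < (\sum_i al i).+1)%N by rewrite ltnS (bigD1 i)//= leq_addr.
rewrite (bigD1 [ffun i => Ordinal (ale i)])//=.
rewrite (_ : (fun i => _) = al); first by rewrite lerDl sumr_ge0.
by apply/funext => i; rewrite ffunE.
Qed.

Lemma box_sum_mpow N (x : R) : box_sum N (mpow x) = (\sum_(j < N.+1) x ^+ j) ^+ d.
Proof.
by rewrite (box_sum_prod _ (fun _ j => x ^+ j)) prodr_const card_ord.
Qed.

(** Each of the d geometric sums is at most 1 / (1 - x) <= 2. *)
Lemma box_sum_mpow_le N (x : R) : 0 <= x <= 2^-1 -> box_sum N (mpow x) <= 2 ^+ d.
Proof.
move=> /andP[x0 x2]; rewrite box_sum_mpow lerXn2r ?nnegrE ?sumr_ge0//.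
  by move=> i _; rewrite exprn_ge0.
have : (1 - x) * \sum_(j < N.+1) x ^+ j <= 1.
  by rewrite -opprB mulNr -subrX1 opprB gerBl exprn_ge0.
have : 0 <= \sum_(j < N.+1) x ^+ j by apply: sumr_ge0 => i _; rewrite exprn_ge0.
by move: (\sum_(j < N.+1) _) => S; nra.
Qed.

Lemma norm_box_sumB_le N M (F G : ('I_d -> nat) -> R) : (N <= M)%N ->
  (forall al, `|F al| <= G al) ->
  `|box_sum M F - box_sum N F| <= box_sum M G - box_sum N G.
Proof.
move=> NM FG; rewrite !box_sumB//.
by rewrite (le_trans (ler_norm_sum _ _ _))//; exact: ler_sum.
Qed.

Lemma cvg_box_sum_mpow_half : cvgn (fun N => box_sum N (mpow 2^-1)).
Proof.
apply: nondecreasing_is_cvgn.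
  by apply: nondecreasing_box_sum => al; rewrite mpow_ge0.
by exists (2 ^+ d) => _ [N _ <-]; rewrite box_sum_mpow_le//; apply/andP; split; lra.
Qed.

Lemma cvg_box_sumZ_mpow_half (K : R) :
  cvgn (fun N => box_sum N (fun al => K * mpow 2^-1 al)).
Proof.
rewrite (_ : (fun N => _) = fun N => K * box_sum N (mpow 2^-1)); last first.
  by apply/funext => N; rewrite box_sumZ.
exact: (is_cvgMr (a := K) cvg_box_sum_mpow_half).
Qed.

(* Comparison without absolute convergence: [F] is the difference of the
   nonnegative families [F + K 2^-|al|] and [K 2^-|al|]. *)
Lemma cvg_box_sum (K : R) (F : ('I_d -> nat) -> R) :
  (forall al, `|F al| <= K * mpow 2^-1 al) -> cvgn (fun N => box_sum N F).
Proof.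
move=> FK; pose G al := K * mpow 2^-1 al.
have FG al : - G al <= F al <= G al by rewrite -ler_norml FK.
have cG : cvgn (fun N => box_sum N G) := @cvg_box_sumZ_mpow_half K.
have G0 al : 0 <= G al by rewrite (le_trans _ (FK al)).
have cFG : cvgn (fun N => box_sum N (fun al => F al + G al)).
  apply: nondecreasing_is_cvgn.
    by apply: nondecreasing_box_sum => al; rewrite -lerBlDr sub0r; case/andP: (FG al).
  exists (limn (fun N => box_sum N (fun al => 2 * G al))) => _ [N _ <-].
  apply: le_trans (_ : box_sum N (fun al => 2 * G al) <= _).
    apply: le_box_sum => al; rewrite mulr_natl mulr2n lerD2r.
    by case/andP: (FG al).
  apply: (nondecreasing_cvgn_le (u_ := fun N => box_sum N (fun al => 2 * G al))).
    by apply: nondecreasing_box_sum => al; rewrite mulr_ge0.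
  rewrite (_ : (fun N => _) = fun N => 2 * box_sum N G); last first.
    by apply/funext => M; rewrite box_sumZ.
  exact: (is_cvgMr (a := 2) cG).
rewrite (_ : (fun N => _) =
  (fun N => box_sum N (fun al => F al + G al)) \- (fun N => box_sum N G)).
  exact: is_cvgB.
by apply/funext => N /=; rewrite /box_sum big_split/= addrK.
Qed.

(** Comparison of increments between cubes N and M, with M sent to infinity. The bound depends on
    [F] only through [K], hence is uniform over a dominated family. *)
Lemma box_sum_tail_le (K : R) (F : ('I_d -> nat) -> R) N :
  (forall al, `|F al| <= K * mpow 2^-1 al) ->
  `|limn (fun M => box_sum M F) - box_sum N F| <=
  K * (limn (fun M => box_sum M (mpow 2^-1)) - box_sum N (mpow 2^-1)).
Proof.
move=> FK.
have cF : (fun M => `|box_sum M F - box_sum N F|) @ \oo -->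
    `|limn (fun M => box_sum M F) - box_sum N F|.
  by apply: cvg_norm; apply: cvgB; [exact: (cvg_box_sum FK)|exact: cvg_cst].
have cG : (fun M => K * (box_sum M (mpow 2^-1) - box_sum N (mpow 2^-1))) @ \oo -->
    K * (limn (fun M => box_sum M (mpow 2^-1)) - box_sum N (mpow 2^-1)).
  by apply: cvgMr; apply: cvgB; [exact: cvg_box_sum_mpow_half|exact: cvg_cst].
apply: (ler_cvg_to cF cG); near=> M.
rewrite mulrBr -!box_sumZ; apply: norm_box_sumB_le => //.
by near: M; exact: nbhs_infty_ge.
Unshelve. all: by end_near. Qed.

(** Dominated convergence for series: one N makes the tails small for all |u| <= 1 at once, and the
    finite sum left over is continuous at 0. *)
Lemma cvg_box_sum_param (K : R) (F : R -> ('I_d -> nat) -> R) :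
  (forall u al, `|u| <= 1 -> `|F u al| <= K * mpow 2^-1 al) ->
  (forall al, F ^~ al @ 0 --> F 0 al) ->
  limn (fun N => box_sum N (F u)) @[u --> 0] --> limn (fun N => box_sum N (F 0)).
Proof.
move=> FK cF; apply/cvgrPdist_le => /= e e0.
have e3 : 0 < e / 3 by rewrite divr_gt0.
have : K * (limn (fun M => box_sum M (mpow 2^-1)) - box_sum N (mpow 2^-1))
    @[N --> \oo] --> K * 0.
  apply: cvgMr; rewrite -[X in _ --> X](subrr (limn (fun M => box_sum M (mpow 2^-1)))).
  by apply: cvgB; [exact: cvg_cst|exact: cvg_box_sum_mpow_half].
rewrite mulr0 => /cvgrPdist_le/(_ _ e3)[N _ /(_ N (leqnn N))]/=.
rewrite sub0r normrN => /(le_trans (ler_norm _)) tailN.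
have cN : box_sum N (F u) @[u --> 0] --> box_sum N (F 0).
  exact: (@cvg_sumr R R (nbhs (0 : R)) _ {ffun 'I_d -> 'I_N.+1}
    (fun f u => F u (fun i => f i)) (fun f => F 0 (fun i => f i)) (fun f => cF _)).
move/cvgrPdist_le : cN => /(_ _ e3) cN.
near=> u.
have u1 : `|u| <= 1 by near: u; exact: (@nbhs0_le R R^o).
set a := limn _; set b := limn _.
have Ha : `|a - box_sum N (F 0)| <= e / 3.
  by apply: le_trans (box_sum_tail_le N _) tailN => al; apply: FK; rewrite normr0.
have Hb : `|b - box_sum N (F u)| <= e / 3.
  by apply: le_trans (box_sum_tail_le N _) tailN => al; apply: FK.
have Hab : `|box_sum N (F 0) - box_sum N (F u)| <= e / 3 by near: u.
move: Ha Hb Hab; rewrite !ler_norml => /andP[? ?] /andP[? ?] /andP[? ?].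
by apply/andP; split; lra.
Unshelve. all: by end_near. Qed.

End box_sums.

(** * Multivariate Newton series and their partial derivatives *)

Section newton_series.
Context {R : realType} {d : nat}.
Implicit Types (x : 'I_d -> R) (a : ('I_d -> nat) -> R).

Definition newton_term x a al : R := (\prod_l nbin (x l) (al l)) * a al.

Definition newton_series x a : R := limn (fun N => box_sum N (newton_term x a)).

(** Growth 4^|al| against decay 8^{-|al|} leaves the rate 2^{-|al|}. The factors [c] are general in
    order to cover [nbin] and [dnbin] alike. *)
Lemma norm_prod_mpow_le T (c : 'I_d -> nat -> R) a K al :
  (forall l m, `|c l m| <= 2 ^+ T * 4 ^+ m) ->
  (forall al, `|a al| <= K * mpow 8^-1 al) ->
  `|(\prod_l c l (al l)) * a al| <= (2 ^+ T) ^+ d * K * mpow 2^-1 al.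
Proof.
move=> cT aK; rewrite normrM.
have -> : (2 ^+ T) ^+ d * K * mpow 2^-1 al =
    (2 ^+ T) ^+ d * mpow 4 al * (K * mpow 8^-1 al).
  by rewrite (_ : 2^-1 = 4 * 8^-1) ?mpowM; [ring|lra].
rewrite ler_pM// normr_prod.
apply: le_trans (_ : \prod_(l < d) (2 ^+ T * 4 ^+ al l) <= _).
  by apply: ler_prod => l _; rewrite normr_ge0 cT.
by rewrite big_split/= prodr_const card_ord.
Qed.

(** The slack [c] leaves room for an increment of the argument. *)
Lemma exists_nat_bound x (c : R) : exists T : nat, forall l, `|x l| + c <= T.+1%:R.
Proof.
exists (Num.truncn (\sum_l `|x l| + `|c|)) => l.
rewrite ltW// (le_lt_trans _ (truncnS_gt _))// lerD ?ler_norm//.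
by rewrite (bigD1 l)//= lerDl sumr_ge0.
Qed.

Lemma cvg_newton_series x a K :
  (forall al, `|a al| <= K * mpow 8^-1 al) ->
  (fun N => box_sum N (newton_term x a)) @ \oo --> newton_series x a.
Proof.
move=> aK; have [T xT] := exists_nat_bound x 0.
apply: (cvg_box_sum (K := (2 ^+ T) ^+ d * K)) => al.
apply: (norm_prod_mpow_le (c := fun l m => nbin (x l) m)) => // l m.
rewrite (le_trans (@norm_nbin_le _ T _ _ _))//.
  by rewrite (le_trans _ (xT l))// addr0.
by rewrite ler_wpM2l ?exprn_ge0// lerXn2r ?nnegrE//; lra.
Qed.

(** Only the factor of coordinate i changes, and by [nbinD] its increment is u u0 times [dnbin]. [Q]
    is the series with that factor replaced by [dnbin]; domination makes it continuous at 0, without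
    any termwise differentiation. *)
Lemma newton_series_increment x a K (i : 'I_d) (u0 : R) :
  (forall al, `|a al| <= K * mpow 8^-1 al) ->
  exists2 Q : R -> R, Q @ 0 --> Q 0 &
    forall u, `|u| <= 1 ->
      newton_series (fun l => x l + (l == i)%:R * (u * u0)) a
      - newton_series x a = u * u0 * Q u.
Proof.
move=> aK; have [T xT] := exists_nat_bound x `|u0|.
pose c u l m := if l == i then dnbin (x l) (u * u0) m else nbin (x l) m.
pose F u al := (\prod_l c u l (al l)) * a al.
have FK u al : `|u| <= 1 -> `|F u al| <= (2 ^+ T) ^+ d * K * mpow 2^-1 al.
  move=> u1; apply: norm_prod_mpow_le => // l m.
  have xlT : `|x l| <= T.+1%:R by rewrite (le_trans _ (xT l))// lerDl.
  rewrite /c; case: ifP => _.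
    apply: norm_dnbin_le => //; rewrite (le_trans (ler_normD _ _))//.
    by rewrite (le_trans _ (xT l))// lerD2l normrM ler_piMl.
  rewrite (le_trans (@norm_nbin_le _ T _ _ _))//.
  by rewrite ler_wpM2l ?exprn_ge0// lerXn2r ?nnegrE//; lra.
exists (fun u => limn (fun N => box_sum N (F u))).
  apply: (cvg_box_sum_param FK) => al; rewrite /F; apply: cvgM; last exact: cvg_cst.
  apply: (@cvg_prodr R R (nbhs (0 : R)) _ 'I_d
    (fun l u => c u l (al l)) (fun l => c 0 l (al l))) => l; rewrite /c; case: ifP => _.
    have := @continuous_dnbin R (x l) (al l) (0 * u0).
    apply: (@cvg_comp _ _ _ (fun u => u * u0) (fun u => dnbin (x l) u (al l))).
    by apply: cvgMl; exact: cvg_id.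
  exact: cvg_cst.
move=> u u1; have cF : cvgn (fun N => box_sum N (F u)).
  by apply: (cvg_box_sum (K := (2 ^+ T) ^+ d * K)) => al; exact: FK.
rewrite /newton_series -limB; try exact: cvg_newton_series aK.
rewrite -(cvg_lim _ (cvgMr (a := u * u0) cF))//; congr (limn _); apply/funext => N.
rewrite -[LHS]/(box_sum N _ - box_sum N _) -box_sumZ /box_sum -sumrB; apply: eq_bigr => f _.
rewrite /newton_term /F -mulrBl mulrA; congr (_ * _).
rewrite (bigD1 i)//= [X in _ - X](bigD1 i)//= [in RHS](bigD1 i)//=.
rewrite /c eqxx mul1r nbinD mulrA.
rewrite (eq_bigr (fun l => nbin (x l) (f l))); last first.
  by move=> l /negbTE ->; rewrite mul0r addr0.
rewrite [in RHS](eq_bigr (fun l => nbin (x l) (f l))); last first.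
  by move=> l /negbTE ->.
by rewrite -mulrBl addrAC subrr add0r.
Qed.

End newton_series.

Lemma derivable_newton_series {R : realType} (d : nat) (h : R)
    (a : ('I_d -> nat) -> R) (K : R) (s : 'rV[R]_d) (i : 'I_d) :
  (forall al, `|a al| <= K * mpow 8^-1 al) ->
  derivable (fun t : 'rV[R]_d => newton_series (fun l => t 0 l / h) a : R)
    s (delta_mx 0 i).
Proof.
move=> aK; have [Q Q0 HQ] :=
  @newton_series_increment R d (fun l => s 0 l / h) a K i h^-1 aK.
(* A step u in s_i moves s_i / h by u / h, so u0 = 1 / h and the difference quotient equals
   [h^-1 * Q u] for small u other than 0. *)
apply/cvg_ex; exists (h^-1 * Q 0).
have : (fun u => h^-1 * Q u) @ 0^' --> h^-1 * Q 0.
  by apply: cvgMr; apply: cvg_trans Q0; apply: cvg_app; exact: nbhs_dnbhs.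
apply: cvg_trans; apply: near_eq_cvg; near=> u => /=.
have u0 : u != 0 by near: u; exact: nbhs_dnbhs_neq.
rewrite (_ : (fun l => _) = (fun l => s 0 l / h + (l == i)%:R * (u * h^-1))).
  rewrite HQ; first by rewrite /GRing.scale/= -mulrA mulKf.
  by near: u; exact: (@dnbhs0_le R R^o).
by apply/funext => l; rewrite !mxE eqxx/= mulrDl addrC mulrA [u * _]mulrC.
Unshelve. all: by end_near. Qed.

(** * Finite Lebesgue measure of cubes *)

Section lebesgue_tuple_cube.
Context {R : realType}.

Lemma measurable_cube n (c : R) :
  measurable [set v : n.-tuple R | forall i, `|tnth v i| <= c].
Proof.
rewrite (_ : [set v | _] =
  \bigcap_(i in [set: 'I_n]) ((fun v : n.-tuple R => tnth v i) @^-1` `[- c, c])).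
  apply: fin_bigcap_measurable => // i _.
  by rewrite -[X in measurable X]setTI; apply: measurable_tnth.
apply/seteqP; split=> v /= vc i; first by rewrite /= in_itv/= -ler_norml.
by move: (vc i I); rewrite /= in_itv/= -ler_norml.
Qed.

Lemma lebesgue_tuple_cube_lty n (c : R) :
  (lebesgue_tuple R n [set v | forall i, (`|tnth v i| <= c)%R] < +oo)%E.
Proof.
have lI : (@lebesgue_measure R `[(- c)%R, c]%classic < +oo)%E.
  by rewrite lebesgue_measure_itv/=; case: ifPn => _; rewrite ?ltry.
elim: n => [|n IH] /=; first by rewrite diracE ltry.
rewrite /cons_measure /pushforward.
rewrite (_ : _ @^-1` _ =
    `[- c, c] `*` [set v : n.-tuple R | forall i, `|tnth v i| <= c]).
  rewrite product_measure1E//; last exact: measurable_cube.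
  by apply: lte_mul_pinfty => //; rewrite ge0_fin_numE.
apply/seteqP; split => -[x v] /=.
  move=> vc; split; first by have := vc ord0; rewrite in_itv/= -ler_norml.
  move=> i; have := vc (lift ord0 i).
  by rewrite (tnth_nth 0)/= (tnth_nth 0).
rewrite in_itv/= -ler_norml => -[xc vc] i; have [j ->|->//] := unliftP ord0 i.
by have := vc j; rewrite !(tnth_nth 0).
Qed.

End lebesgue_tuple_cube.

(** * Positivity of the spectral denominator *)

Section permissible_density.
Context {R : realType}.

(** Here u stands for (|k| xi)^2. A uniform lower bound, rather than mere positivity, keeps the
    spectral density bounded on the ball. *)
Lemma permissible_denominator (eta1 xi kc : R) :
  0 < xi -> 0 < kc -> permissible eta1 xi kc ->
  exists2 delta, 0 < delta &
    forall u, 0 <= u <= (kc * xi) ^+ 2 -> delta <= 1 + eta1 * u + u ^+ 2.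
Proof.
move=> xi0 kc0 [e2|[e2 kx]].
  have [e0|e0] := leP 0 eta1.
    by exists 1 => // u /andP[u0 _]; have := mulr_ge0 e0 u0; have := sqr_ge0 u; lra.
  (* The minimum of the quadratic, attained at u = - eta1 / 2. *)
  exists (1 - eta1 ^+ 2 / 4) => [|u _].
    have : 0 < (eta1 + 2) * (2 - eta1) by apply: mulr_gt0; lra.
    by nra.
  by have := sqr_ge0 (u + eta1 / 2); nra.
have D2 : 0 < eta1 ^+ 2 - 4.
  have : 0 < (- eta1 + 2) * (- eta1 - 2) by apply: mulr_gt0; lra.
  by nra.
set D := Num.sqrt (eta1 ^+ 2 - 4) in kx.
have DD : D ^+ 2 = eta1 ^+ 2 - 4 by rewrite sqr_sqrtr// ltW.
have D0 : 0 <= D by rewrite sqrtr_ge0.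
have De : D < - eta1.
  by rewrite -(@ltr_pXn2r _ 2)// ?nnegrE ?DD//; [rewrite sqrrN; lra|lra].
(* Squared, the permissibility condition puts (kc xi)^2 below the smaller root of the quadratic. *)
have u1 : (kc * xi) ^+ 2 < (- eta1 - D) / 2.
  have -> : (- eta1 - D) / 2 = ((Num.sqrt 2)^-1 * Num.sqrt (- eta1 - D)) ^+ 2.
    by rewrite exprMn exprVn !sqr_sqrtr//; [exact: mulrC|lra].
  rewrite ltrXn2r// ?nnegrE ?mulr_ge0// ?invr_ge0//; [exact: ltW|exact: ltW|].
  by rewrite ltr0_norm in kx; lra.
set U := (kc * xi) ^+ 2 in u1 *.
(* The value of the quadratic at the endpoint [U]: to the left of both roots its two linear factors
   are positive and decreasing. *)
exists (((- eta1 - D) / 2 - U) * ((- eta1 + D) / 2 - U)).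
  by apply: mulr_gt0; lra.
move=> u /andP[u0 uU].
have -> : 1 + eta1 * u + u ^+ 2 = ((- eta1 - D) / 2 - u) * ((- eta1 + D) / 2 - u).
  apply/eqP; rewrite -subr_eq0; apply/eqP.
  by transitivity ((D ^+ 2 - (eta1 ^+ 2 - 4)) / 4); [field|rewrite DD; lra].
by apply: ler_pM; lra.
Qed.

End permissible_density.

(** * The spectral ball and integrability of the density on it *)

Section euclidean_ball.
Context {R : realType} {d : nat}.
Implicit Types (k : d.-tuple R) (kc : R) (r : 'rV[R]_d).

Lemma le_euclidean_norm k i : `|tnth k i| <= euclidean_norm k.
Proof.
rewrite -sqrtr_sqr ler_sqrt ?sumr_ge0// => [|j _]; last exact: sqr_ge0.
by rewrite (bigD1 i)//= lerDl sumr_ge0// => j _; exact: sqr_ge0.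
Qed.

Lemma measurable_euclidean_norm :
  measurable_fun [set: d.-tuple R] (@euclidean_norm R d).
Proof.
apply: (measurableT_comp (f := @Num.sqrt R)).
  by apply: continuous_measurable_fun; exact: sqrt_continuous.
by apply: measurable_sum => i; apply: measurable_funX; exact: measurable_tnth.
Qed.

Lemma measurable_dotp r : measurable_fun [set: d.-tuple R] (fun k => dotp k r).
Proof.
by apply: measurable_sum => i; apply: measurable_funM => //; exact: measurable_tnth.
Qed.

Lemma measurable_euclidean_ball kc :
  measurable [set k : d.-tuple R | euclidean_norm k <= kc].
Proof.
rewrite (_ : [set k | _] = (@euclidean_norm R d) @^-1` `]-oo, kc]).
  rewrite -[X in measurable X]setTI; exact: measurable_euclidean_norm.
by apply/seteqP; split=> k /=; rewrite in_itv.
Qed.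

Lemma euclidean_ball_lty kc :
  (lebesgue_tuple R d [set k | (euclidean_norm k <= kc)%R] < +oo)%E.
Proof.
apply: le_lt_trans (lebesgue_tuple_cube_lty d kc).
apply: le_measure; rewrite ?inE; [exact: measurable_euclidean_ball|exact: measurable_cube|].
by move=> k /= kkc i; exact: le_trans (le_euclidean_norm k i) kkc.
Qed.

Lemma measurable_inv_ge (dsp : measure_display) (T : measurableType dsp) (D : set T)
    (f : T -> R) (delta : R) : 0 < delta -> (forall x, D x -> delta <= f x) ->
  measurable_fun D f -> measurable_fun D (fun x => (f x)^-1).
Proof.
move=> delta0 fdelta mf.
(* Truncation from below at [delta] makes inversion continuous on the whole line and changes nothing
   at the values of [f] on [D]. *)
have cg : continuous (fun y : R => (Num.max delta y)^-1).
  move=> y; apply: cvgV; first by rewrite gt_eqF// lt_max delta0.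
  by apply: continuous_max; [exact: cvg_cst|exact: cvg_id].
apply: (eq_measurable_fun (fun x => (Num.max delta (f x))^-1)).
  by move=> x; rewrite inE => /fdelta fx; rewrite max_r.
exact: (measurableT_comp (continuous_measurable_fun cg) mf).
Qed.

Lemma spectral_density_bounds (eta0 eta1 xi kc : R) :
  0 < eta0 -> 0 < xi -> 0 < kc -> permissible eta1 xi kc ->
  measurable_fun [set k : d.-tuple R | euclidean_norm k <= kc]
    (spectral_density eta0 eta1 xi) /\
  exists M, forall k, euclidean_norm k <= kc ->
    0 <= spectral_density eta0 eta1 xi k <= M.
Proof.
move=> eta00 xi0 kc0 /(permissible_denominator xi0 kc0)[delta delta0 H].
have den k : euclidean_norm k <= kc -> delta <=
    1 + eta1 * (euclidean_norm k * xi) ^+ 2 + (euclidean_norm k * xi) ^+ 4.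
  move=> kkc; rewrite (_ : _ ^+ 4 = ((euclidean_norm k * xi) ^+ 2) ^+ 2).
    by apply: H; rewrite sqr_ge0/= lerXn2r ?nnegrE ?mulr_ge0 ?sqrtr_ge0 ?ler_pM2r// ltW.
  by rewrite -exprM.
have eta0_ge0 : 0 <= eta0 * xi ^+ d by rewrite mulr_ge0 ?exprn_ge0 ?ltW.
split.
  apply: measurable_funM => //; apply: (measurable_inv_ge delta0) => //.
  have mX n : measurable_fun [set k : d.-tuple R | euclidean_norm k <= kc]
      (fun k => (euclidean_norm k * xi) ^+ n).
    apply: measurable_funTS; apply: measurable_funX; apply: measurable_funM => //.
    exact: measurable_euclidean_norm.
  by apply: measurable_funD => //; apply: measurable_funD => //; apply: measurable_funM.
exists (eta0 * xi ^+ d / delta) => k /den dk.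
have d0 := lt_le_trans delta0 dk.
by rewrite divr_ge0 ?(ltW d0)// ler_wpM2l// lef_pV2 ?posrE.
Qed.

Lemma integrable_spectral (eta0 eta1 xi kc : R) (f : d.-tuple R -> R) (C : R) :
  0 < eta0 -> 0 < xi -> 0 < kc -> permissible eta1 xi kc ->
  measurable_fun [set: d.-tuple R] f -> (forall k, `|f k| <= C) ->
  (lebesgue_tuple R d).-integrable [set k | euclidean_norm k <= kc]
    (fun k => (f k * spectral_density eta0 eta1 xi k)%:E).
Proof.
move=> eta00 xi0 kc0 perm mf fC.
have [mw [M wM]] := @spectral_density_bounds _ _ xi kc eta00 xi0 kc0 perm.
apply: (measurable_bounded_integrable (f := fun k => f k * _)).
- exact: measurable_euclidean_ball.
- exact: euclidean_ball_lty.
- by apply: measurable_funM => //; exact: measurable_funTS.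
- exists (C * M); split; first exact: num_real.
  move=> x Mx k /= /wM /andP[w0 wMk]; apply: le_trans (ltW Mx).
  by rewrite normrM ler_pM// ger0_norm.
Qed.

End euclidean_ball.

(** * Real integrals of finite sums *)

Section Rintegral_sum.
Context {dsp : measure_display} {T : measurableType dsp} {R : realType}.
Context {mu : {measure set T -> \bar R}} {D : set T} {I : Type}.
Implicit Types (s : seq I) (f : I -> T -> R).

Lemma integrable_sumr s f : measurable D ->
  (forall i, mu.-integrable D (fun x => (f i x)%:E)) ->
  mu.-integrable D (fun x => (\sum_(i <- s) f i x)%:E).
Proof.
move=> mD fi; rewrite (_ : (fun x => _) = fun x => (\sum_(i <- s) (f i x)%:E)%E).
  by apply: integrable_sum => // i _; exact: fi.
by apply/funext => x; rewrite sumEFin.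
Qed.

Lemma Rintegral_sum s f : measurable D ->
  (forall i, mu.-integrable D (fun x => (f i x)%:E)) ->
  \int[mu]_(x in D) (\sum_(i <- s) f i x) = \sum_(i <- s) \int[mu]_(x in D) f i x.
Proof.
move=> mD fi; elim: s => [|i s IH].
  rewrite big_nil (_ : (fun x => _) = cst 0); first by rewrite Rintegral_cst// mul0r.
  by apply/funext => x; rewrite big_nil.
rewrite big_cons -IH -RintegralD//; last 2 first.
- exact: fi.
- exact: integrable_sumr.
by apply: eq_Rintegral => x _; rewrite big_cons.
Qed.

End Rintegral_sum.

(** * Finite combinations of field values and their transfer functions *)

Section linear_combinations.
Context {disp : measure_display} {T : measurableType disp} {R : realType}
  {P : probability T R} {d : nat}.
Implicit Types (X : 'rV[R]_d -> {RV P >-> R}) (L : seq (R * 'rV[R]_d)).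

(* A list of pairs (c, s) stands for the variable \sum c X(s); its transfer function
   \sum c e^{i k.s} is the image of that variable under the spectral isometry. *)
Definition lincomb X L (w : T) : R := \sum_(p <- L) p.1 * X p.2 w.

Definition transfer L (k : d.-tuple R) : R[i] :=
  \sum_(p <- L) p.1%:C%C * expi (dotp k p.2).

Lemma dotpB (k : d.-tuple R) (r s : 'rV[R]_d) : dotp k (r - s) = dotp k r - dotp k s.
Proof. by rewrite /dotp -sumrB; apply: eq_bigr => i _; rewrite !mxE mulrBr. Qed.

(** The cosines of lags p.2 - q.2 are the kernels through which the spectral density yields the
    covariance. *)
Lemma sqr_normc_transfer L k : normc (transfer L k) ^+ 2 =
  \sum_(p <- L) \sum_(q <- L) p.1 * q.1 * cos (dotp k (p.2 - q.2)).
Proof.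
have Re_sum : complex.Re (transfer L k) = \sum_(p <- L) p.1 * cos (dotp k p.2).
  rewrite /transfer; elim: L => [|p L IH]; first by rewrite !big_nil.
  by rewrite !big_cons -IH; case: (\sum_(_ <- _) _) => ? ? /=; rewrite mul0r subr0.
have Im_sum : complex.Im (transfer L k) = \sum_(p <- L) p.1 * sin (dotp k p.2).
  rewrite /transfer; elim: {Re_sum} L => [|p L IH]; first by rewrite !big_nil.
  by rewrite !big_cons -IH; case: (\sum_(_ <- _) _) => ? ? /=; rewrite mul0r addr0.
rewrite sqr_normcE Re_sum Im_sum !expr2 !mulr_suml -big_split/=.
apply: eq_bigr => p _; rewrite !mulr_sumr -big_split/=; apply: eq_bigr => q _.
by rewrite dotpB cosB; ring.
Qed.

Lemma measurable_lincomb X L : measurable_fun [set: T] (lincomb X L).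
Proof. by apply: measurable_sum => p; apply: measurable_funM. Qed.

End linear_combinations.

(** * The spectral isometry *)

Section second_moment.
Context {disp : measure_display} {T : measurableType disp} {R : realType}
  {P : probability T R} {d : nat} {eta0 eta1 xi kc : R}
  {X : 'rV[R]_d -> {RV P >-> R}}.
Context (eta00 : 0 < eta0) (xi0 : 0 < xi) (kc0 : 0 < kc)
  (perm : permissible eta1 xi kc) (HX : FGC_SSRF eta0 eta1 xi kc X).

Lemma covariance_FGC_SSRF s t :
  covariance P (X s) (X t) = (\int[P]_w (X s w * X t w)%:E)%E.
Proof.
rewrite unlock !(FGC_SSRF_mean HX) unlock; apply: eq_integral => w _; rewrite fctE/=.
by rewrite !subr0.
Qed.

(** Squares are integrable because the covariance at lag 0 is a real number; products follow from
    |ab| <= a^2 + b^2. *)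
Lemma integrable_field2 s t : P.-integrable [set: T] (fun w => (X s w * X t w)%:E).
Proof.
have L2 u : P.-integrable [set: T] (fun w => (X u w * X u w)%:E).
  apply/integrableP; split.
    by apply/measurable_EFinP; apply: measurable_funM.
  have [c + _] := FGC_SSRF_covariance HX u 0.
  rewrite addr0 covariance_FGC_SSRF => cE.
  rewrite (eq_integral (fun w => (X u w * X u w)%:E)) ?cE ?ltry// => w _.
  by rewrite gee0_abs// lee_fin -expr2 sqr_ge0.
have := integrableD measurableT (L2 s) (L2 t).
apply: le_integrable => //; first by apply/measurable_EFinP; apply: measurable_funM.
move=> w _ /=; rewrite lee_fin [leRHS]ger0_norm; last first.
  by rewrite addr_ge0// -expr2 sqr_ge0.
have := sqr_ge0 (X s w - X t w); have := sqr_ge0 (X s w + X t w).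
by rewrite ler_norml; move: (X s w) (X t w) => a b ? ?; apply/andP; split; nra.
Qed.

Lemma field_moment s t : \int[P]_w (X s w * X t w) =
  ((2 * pi) ^+ d)^-1 * \int[lebesgue_tuple R d]_(k in [set k | euclidean_norm k <= kc])
    (cos (dotp k (s - t)) * spectral_density eta0 eta1 xi k).
Proof.
have [c + /(congr1 (@complex.Re R))] := FGC_SSRF_covariance HX t (s - t).
rewrite subrKC covariance_FGC_SSRF /Rintegral => -> /= ->.
rewrite mul0r subr0; congr (_ * _).
by apply: eq_Rintegral => k _ /=; rewrite mulr0 subr0.
Qed.

(** This is the variance E X(0)^2, by [field_moment] with s = t = 0. *)
Definition spectral_mass : R :=
  ((2 * pi) ^+ d)^-1 *
  \int[lebesgue_tuple R d]_(k in [set k | euclidean_norm k <= kc])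
    spectral_density eta0 eta1 xi k.

Lemma integrable_sqr_lincomb L :
  P.-integrable [set: T] (fun w => (lincomb X L w ^+ 2)%:E).
Proof.
rewrite (_ : (fun w => _) = fun w => (\sum_(p <- L) \sum_(q <- L)
    p.1 * q.1 * (X p.2 w * X q.2 w))%:E).
  apply: integrable_sumr => // p; apply: integrable_sumr => // q.
  exact: (integrableZl measurableT (p.1 * q.1) (integrable_field2 p.2 q.2)).
apply/funext => w; rewrite expr2 mulr_suml; congr EFin; apply: eq_bigr => p _.
by rewrite mulr_sumr; apply: eq_bigr => q _; ring.
Qed.

Lemma integrable_cos (r : 'rV[R]_d) : (lebesgue_tuple R d).-integrable
  [set k | euclidean_norm k <= kc]
  (fun k => (cos (dotp k r) * spectral_density eta0 eta1 xi k)%:E).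
Proof.
apply: (integrable_spectral (C := 1)) => // [|k]; last first.
  by rewrite ler_norml cos_geN1 cos_le1.
apply: (measurableT_comp (f := @cos R)); last exact: measurable_dotp.
exact: continuous_measurable_fun (@continuous_cos R).
Qed.

Lemma transfer_density L (k : d.-tuple R) :
  normc (transfer L k) ^+ 2 * spectral_density eta0 eta1 xi k =
  \sum_(p <- L) \sum_(q <- L) p.1 * q.1 *
    (cos (dotp k (p.2 - q.2)) * spectral_density eta0 eta1 xi k).
Proof.
rewrite sqr_normc_transfer mulr_suml; apply: eq_bigr => p _.
by rewrite mulr_suml; apply: eq_bigr => q _; rewrite mulrA.
Qed.

Lemma integrable_transfer L : (lebesgue_tuple R d).-integrable
  [set k | euclidean_norm k <= kc]
  (fun k => (normc (transfer L k) ^+ 2 * spectral_density eta0 eta1 xi k)%:E).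
Proof.
have mB := @measurable_euclidean_ball R d kc.
rewrite (funext (fun k => congr1 EFin (transfer_density L k))).
apply: integrable_sumr => // p; apply: integrable_sumr => // q.
exact: (integrableZl mB (p.1 * q.1) (integrable_cos (p.2 - q.2))).
Qed.

(** The isometry on finite combinations: both sides expand into the same double sum over pairs of
    nodes, matched term by term by [field_moment]. *)
Lemma second_moment_lincomb L : \int[P]_w (lincomb X L w ^+ 2) =
  ((2 * pi) ^+ d)^-1 * \int[lebesgue_tuple R d]_(k in [set k | euclidean_norm k <= kc])
    (normc (transfer L k) ^+ 2 * spectral_density eta0 eta1 xi k).
Proof.
have mB := @measurable_euclidean_ball R d kc.
transitivity (\sum_(p <- L) \sum_(q <- L) p.1 * q.1 * \int[P]_w (X p.2 w * X q.2 w)).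
  transitivity (\int[P]_w (\sum_(p <- L) \sum_(q <- L)
      p.1 * q.1 * (X p.2 w * X q.2 w))).
    apply: eq_Rintegral => w _; rewrite expr2 mulr_suml; apply: eq_bigr => p _.
    by rewrite mulr_sumr; apply: eq_bigr => q _; ring.
  have iX p q := integrableZl measurableT (p.1 * q.1) (integrable_field2 p.2 q.2).
  rewrite Rintegral_sum// => [|p]; last by apply: integrable_sumr => // q; exact: iX.
  apply: eq_bigr => p _; rewrite Rintegral_sum// => [|q]; last exact: iX.
  by apply: eq_bigr => q _; rewrite RintegralZl//; exact: integrable_field2.
under eq_bigr do under eq_bigr do rewrite field_moment mulrCA.
under eq_bigr do rewrite -mulr_sumr.
rewrite -mulr_sumr; congr (_ * _).
transitivity (\int[lebesgue_tuple R d]_(k in [set k | euclidean_norm k <= kc])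
    (\sum_(p <- L) \sum_(q <- L) p.1 * q.1 *
      (cos (dotp k (p.2 - q.2)) * spectral_density eta0 eta1 xi k))).
  have iX p q := integrableZl mB (p.1 * q.1) (integrable_cos (p.2 - q.2)).
  rewrite Rintegral_sum// => [|p]; last by apply: integrable_sumr => // q; exact: iX.
  apply: eq_bigr => p _; rewrite Rintegral_sum// => [|q]; last exact: iX.
  by apply: eq_bigr => q _; rewrite RintegralZl//; exact: integrable_cos.
by apply: eq_Rintegral => k _; rewrite transfer_density.
Qed.

Lemma spectral_mass_ge0 : 0 <= spectral_mass.
Proof.
have [_ [M wM]] := @spectral_density_bounds R d _ _ _ _ eta00 xi0 kc0 perm.
rewrite mulr_ge0 ?invr_ge0 ?exprn_ge0 ?mulr_ge0 ?pi_ge0//.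
by apply: Rintegral_ge0 => k /wM /andP[].
Qed.

(** All mean-square estimates reduce through this to uniform bounds of a transfer function on the
    spectral ball. *)
Lemma second_moment_lincomb_le L B : 0 <= B ->
  (forall k, euclidean_norm k <= kc -> normc (transfer L k) <= B) ->
  (\int[P]_w (lincomb X L w ^+ 2)%:E <= (B ^+ 2 * spectral_mass)%:E)%E.
Proof.
move=> B0 LB.
have [mw [M wM]] := @spectral_density_bounds R d _ _ _ _ eta00 xi0 kc0 perm.
have mB := @measurable_euclidean_ball R d kc.
have -> : (\int[P]_w (lincomb X L w ^+ 2)%:E = (\int[P]_w (lincomb X L w ^+ 2))%:E)%E.
  by rewrite /Rintegral fineK//; apply: integrable_fin_num => //; exact: integrable_sqr_lincomb.
rewrite lee_fin second_moment_lincomb mulrCA ler_wpM2l//.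
  by rewrite invr_ge0 exprn_ge0// mulr_ge0 ?pi_ge0.
have iw : (lebesgue_tuple R d).-integrable [set k | euclidean_norm k <= kc]
    (fun k => (spectral_density eta0 eta1 xi k)%:E).
  have := @integrable_spectral R d _ _ _ _ (cst 1) 1 eta00 xi0 kc0 perm.
  rewrite (_ : (fun k => (_ * _)%:E) = fun k => (spectral_density eta0 eta1 xi k)%:E).
    by apply => // k; rewrite normr1.
  by apply/funext => k; rewrite mul1r.
rewrite -RintegralZl//; apply: le_Rintegral => //.
- exact: integrable_transfer.
- exact: (integrableZl mB (B ^+ 2) iw).
move=> k kkc; have /andP[w0 _] := wM k kkc.
by rewrite ler_wpM2r// lerXn2r ?nnegrE ?normc_ge0// LB.
Qed.

End second_moment.

(** * Iterated differences and Newton partial sums as finite combinations *)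

Section finite_differences.
Context {disp : measure_display} {T : measurableType disp} {R : realType}
  {P : probability T R} {d : nat}.
Implicit Types (X : 'rV[R]_d -> {RV P >-> R}) (L : seq (R * 'rV[R]_d))
  (k : d.-tuple R) (al : 'I_d -> nat) (h : R) (s : 'rV[R]_d).

Lemma transfer_cat L1 L2 k : transfer (L1 ++ L2) k = transfer L1 k + transfer L2 k.
Proof. by rewrite /transfer big_cat. Qed.

Lemma lincomb_cat X L1 L2 w : lincomb X (L1 ++ L2) w = lincomb X L1 w + lincomb X L2 w.
Proof. by rewrite /lincomb big_cat. Qed.

Definition scale_comb (c : R) L := [seq (c * p.1, p.2) | p <- L].

Lemma transfer_scale c L k : transfer (scale_comb c L) k = c%:C%C * transfer L k.
Proof.
rewrite /transfer big_map mulr_sumr; apply: eq_bigr => p _.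
by rewrite mulrA -rmorphM.
Qed.

Lemma lincomb_scale X c L w : lincomb X (scale_comb c L) w = c * lincomb X L w.
Proof.
by rewrite /lincomb big_map mulr_sumr; apply: eq_bigr => p _; rewrite mulrA.
Qed.

Definition difference (h : R) (i : 'I_d) L :=
  [seq (p.1, p.2 + h *: delta_mx 0 i) | p <- L] ++ scale_comb (-1) L.

Lemma dotp_shift k r h i : dotp k (r + h *: delta_mx 0 i) = dotp k r + tnth k i * h.
Proof.
rewrite /dotp (eq_bigr (fun j => tnth k j * r 0 j + tnth k j * h * (j == i)%:R)).
  rewrite big_split/=; congr (_ + _).
  by rewrite (bigD1 i)//= eqxx mulr1 big1 ?addr0// => j /negbTE ->; rewrite mulr0.
by move=> j _; rewrite !mxE eqxx/= mulrDr mulrA.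
Qed.

(** Shifting all nodes by h along axis i multiplies the transfer function by e^{i h k_i}. *)
Lemma transfer_difference h i L k :
  transfer (difference h i L) k = (expi (tnth k i * h) - 1) * transfer L k.
Proof.
rewrite transfer_cat transfer_scale rmorphN1 mulrBl mul1r mulN1r; congr (_ - _).
rewrite /transfer big_map mulr_sumr; apply: eq_bigr => p _.
by rewrite dotp_shift expiD; ring.
Qed.

(** Encodes D^al X(0), starting from the single node 0 with weight 1. *)
Definition differences (h : R) al : seq (R * 'rV[R]_d) :=
  foldr (fun i L => iter (al i) (difference h i) L) [:: (1, 0)] (enum 'I_d).

Lemma transfer_differences h al k :
  transfer (differences h al) k = \prod_i (expi (tnth k i * h) - 1) ^+ al i.
Proof.
rewrite -big_enum /differences; elim: (enum _) => [|i s IH] /=.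
  by rewrite big_nil /transfer big_seq1/= mul1r /dotp big1 ?expi0// => i _; rewrite mxE mulr0.
rewrite big_cons -IH; elim: (al i) => [|n IHn] /=; first by rewrite mul1r.
by rewrite transfer_difference IHn exprS mulrA.
Qed.

Lemma normc_transfer_differences_le h al k : (forall i, `|tnth k i * h| <= 64^-1) ->
  normc (transfer (differences h al) k) <= mpow 32^-1 al.
Proof.
move=> kh; rewrite transfer_differences normc_prod; apply: ler_prod => i _.
rewrite normc_ge0/= normcX lerXn2r ?nnegrE ?normc_ge0 ?invr_ge0//.
by rewrite (le_trans (normc_expi_sub1 _))//; have := kh i; lra.
Qed.

Definition newton_comb (h : R) (s : 'rV[R]_d) N : seq (R * 'rV[R]_d) :=
  flatten [seq scale_comb (\prod_l nbin (s 0 l / h) (f l)) (differences h (fun i => f i))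
          | f : {ffun 'I_d -> 'I_N.+1}].

Lemma lincomb_newton_comb X h s N w : lincomb X (newton_comb h s N) w =
  box_sum N (newton_term (fun l => s 0 l / h)
               (fun al => lincomb X (differences h al) w)).
Proof.
rewrite /lincomb /newton_comb big_flatten big_image/=; apply: eq_bigr => f _.
exact: lincomb_scale.
Qed.

(** Summation over a cube lets the multivariate Newton sum factor, so the one-dimensional error
    estimate suffices. *)
Lemma transfer_newton_comb h s N k : transfer (newton_comb h s N) k =
  \prod_i newton_sum (s 0 i / h) N.+1 (expi (tnth k i * h) - 1).
Proof.
rewrite /transfer /newton_comb big_flatten big_image/=.
rewrite /newton_sum -(box_sum_prod _ (fun i j =>
  (nbin (s 0 i / h) j)%:C%C * (expi (tnth k i * h) - 1) ^+ j)).
apply: eq_bigr => f _; rewrite big_split/= -transfer_differences.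
by rewrite -/(transfer _ _) transfer_scale rmorph_prod.
Qed.

(** Induction through aA - bB = (a - b) A + b (A - B), with |A| = 1 and |b| <= 1 + e; the bound
    reproduces itself since e + (1 + e) ((1 + e)^n - 1) = (1 + e)^{n+1} - 1. *)
Lemma normc_prodB_le (I : Type) (r : seq I) (a b : I -> R[i]) (e : R) :
  (forall i, normc (a i) = 1) -> (forall i, normc (a i - b i) <= e) ->
  normc (\prod_(i <- r) a i - \prod_(i <- r) b i) <= (1 + e) ^+ size r - 1.
Proof.
move=> a1 abe; elim: r => [|i r IH].
  by rewrite !big_nil !subrr normc0.
have e0 : 0 <= e by rewrite (le_trans _ (abe i))// normc_ge0.
rewrite !big_cons /=; set A := \prod_(_ <- r) a _; set B := \prod_(_ <- r) b _.
have -> : a i * A - b i * B = (a i - b i) * A + b i * (A - B) by ring.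
have A1 : normc A = 1.
  by rewrite /A; elim: (r) => [|j q IHq]; rewrite ?big_nil ?normc1// big_cons normcM a1 IHq mulr1.
have b1 : normc (b i) <= 1 + e.
  have -> : b i = a i + - (a i - b i) by ring.
  by rewrite (le_trans (le_normcD _ _))// a1 normcN lerD2l abe.
rewrite (le_trans (le_normcD _ _))// !normcM A1 mulr1 exprS.
have := ler_pM (normc_ge0 _) (normc_ge0 _) b1 IH.
by have := abe i; lra.
Qed.

Lemma normc_newton_comb_error_le h s N k (M : nat) : h != 0 ->
  (forall i, `|tnth k i * h| <= 64^-1) ->
  (forall i, `|s 0 i / h| <= M.+1%:R) ->
  normc (transfer (newton_comb h s N ++ [:: (-1, s)]) k) <=
    (1 + M.+1%:R * 2 ^+ M * 8^-1 ^+ N) ^+ d - 1.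
Proof.
move=> h0 kh sM; rewrite transfer_cat transfer_newton_comb.
(* The appended pair subtracts X(s); its character e^{i k.s} splits over the axes like the Newton
   product. *)
rewrite [X in _ + X](_ : _ = - \prod_i expi (s 0 i / h * (tnth k i * h))); last first.
  rewrite /transfer big_seq1 rmorphN1 mulN1r -expi_sum; congr (- expi _).
  by apply: eq_bigr => i _; rewrite mulrCA mulfVK// mulrC.
rewrite normcB; have := @normc_prodB_le _ (index_enum 'I_d)
  (fun i => expi (s 0 i / h * (tnth k i * h)))
  (fun i => newton_sum (s 0 i / h) N.+1 (expi (tnth k i * h) - 1))
  (M.+1%:R * 2 ^+ M * 8^-1 ^+ N).
rewrite (_ : size _ = d); last by rewrite -[RHS]card_ord cardT enumT.
apply => i; first exact: normc_expi.
exact: newton_sum_error.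
Qed.

Lemma cvg_newton_comb_error (M : nat) :
  (fun N => (1 + M.+1%:R * 2 ^+ M * 8^-1 ^+ N) ^+ d - 1 : R) @ \oo --> 0.
Proof.
have H : (fun N => 1 + M.+1%:R * 2 ^+ M * 8^-1 ^+ N : R) @ \oo --> (1 : R).
  rewrite -[X in _ --> X]addr0; apply: cvgD; first exact: cvg_cst.
  rewrite -[X in _ --> X](mulr0 (M.+1%:R * 2 ^+ M)); apply: cvgMr.
  by apply: cvg_expr; rewrite ger0_norm; lra.
rewrite [X in _ --> X](_ : _ = 1 ^+ d - 1); last by rewrite expr1n subrr.
apply: cvgB; last exact: cvg_cst.
exact: (cvg_comp _ _ H (@exprn_continuous R d 1)).
Qed.

End finite_differences.

(** * The Newton series of the sampled field as a differentiable version *)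

Section newton_version.
Context {disp : measure_display} {T : measurableType disp} {R : realType}
  {P : probability T R} {d : nat} {eta0 eta1 xi kc : R}
  {X : 'rV[R]_d -> {RV P >-> R}}.
Context (eta00 : 0 < eta0) (xi0 : 0 < xi) (kc0 : 0 < kc)
  (perm : permissible eta1 xi kc) (HX : FGC_SSRF eta0 eta1 xi kc X).

Definition mesh : R := (64 * kc)^-1.

Lemma mesh_gt0 : 0 < mesh.
Proof. by rewrite invr_gt0 mulr_gt0. Qed.

Lemma ball_mesh_le (k : d.-tuple R) i :
  euclidean_norm k <= kc -> `|tnth k i * mesh| <= 64^-1.
Proof.
move=> /(le_trans (le_euclidean_norm k i)) ki.
rewrite normrM (ger0_norm (ltW mesh_gt0)) /mesh invfM mulrCA.
by rewrite -[leRHS]mulr1 ler_wpM2l ?invr_ge0// ler_pdivrMr// mul1r.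
Qed.

Definition node_difference (al : 'I_d -> nat) : T -> R := lincomb X (differences mesh al).

(* The mean square of the term of index al is O((64 / 1024)^|al|). *)
Definition energy N w : R :=
  box_sum N (fun al => node_difference al w ^+ 2 * mpow 64 al).

Definition total_energy w : \bar R := limn (fun N => (energy N w)%:E).

Lemma energy_term_ge0 w (al : 'I_d -> nat) :
  0 <= node_difference al w ^+ 2 * mpow 64 al.
Proof. by rewrite mulr_ge0 ?sqr_ge0 ?mpow_ge0. Qed.

Lemma measurable_energy N : measurable_fun [set: T] (energy N).
Proof.
apply: measurable_sum => f; apply: measurable_funM => //.
by apply: measurable_funX; exact: measurable_lincomb.
Qed.

Lemma nondecreasing_energy w :
  {homo (fun N => (energy N w)%:E) : N M / (N <= M)%N >-> (N <= M)%E}.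
Proof.
move=> N M NM; rewrite lee_fin.
by apply: nondecreasing_box_sum NM => al; exact: energy_term_ge0.
Qed.

Lemma energy_ge0 N w : 0 <= energy N w.
Proof. by apply: sumr_ge0 => f _; exact: energy_term_ge0. Qed.

(** Each squared difference has mean at most 32^{-2|al|} times the variance; the weight 64^|al|
    leaves 16^{-|al|}, whose sum over any cube is at most 2^d. *)
Lemma integral_energy_le N :
  (\int[P]_w (energy N w)%:E <= (@spectral_mass R d eta0 eta1 xi kc * 2 ^+ d)%:E)%E.
Proof.
have m2 al : measurable_fun [set: T] (fun w => (node_difference al w ^+ 2)%:E).
  by apply/measurable_EFinP; apply: measurable_funX; exact: measurable_lincomb.
rewrite (eq_integral (fun w => \sum_(f : {ffun 'I_d -> 'I_N.+1})
    ((mpow 64 (fun i => f i))%:E * (node_difference (fun i => f i) w ^+ 2)%:E))%E).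
  rewrite ge0_integral_sum//; last 2 first.
  - by move=> f; exact: measurable_funeM.
  - by move=> f w _; rewrite -EFinM lee_fin mulrC energy_term_ge0.
  apply: (@le_trans _ _ (\sum_(f : {ffun 'I_d -> 'I_N.+1})
      (mpow 64 (fun i => f i) * (mpow 32^-1 (fun i => f i) ^+ 2 *
        @spectral_mass R d eta0 eta1 xi kc))%:E)%E).
    apply: lee_sum => f _; rewrite ge0_integralZl//; last 2 first.
    - by move=> w _; rewrite lee_fin sqr_ge0.
    - by rewrite lee_fin mpow_ge0.
    rewrite EFinM lee_wpmul2l// ?lee_fin ?mpow_ge0//.
    apply: (second_moment_lincomb_le eta00 xi0 kc0 perm HX) => [|k kkc].
      by rewrite mpow_ge0// invr_ge0.
    by apply: normc_transfer_differences_le => i; exact: ball_mesh_le.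
  rewrite sumEFin lee_fin.
  rewrite (eq_bigr (fun f : {ffun 'I_d -> 'I_N.+1} =>
      @spectral_mass R d eta0 eta1 xi kc * mpow 16^-1 (fun i => f i))).
    rewrite -mulr_sumr ler_wpM2l//.
      exact: (spectral_mass_ge0 (d := d) eta00 xi0 kc0 perm).
    by apply: box_sum_mpow_le; apply/andP; split; lra.
  move=> f _; rewrite (_ : 16^-1 = 64 * (32^-1 * 32^-1)); last by lra.
  by rewrite !mpowM; ring.
move=> w _; rewrite /energy /box_sum -sumEFin; apply: eq_bigr => f _.
by rewrite -EFinM mulrC.
Qed.

Lemma measurable_total_energy : measurable_fun [set: T] total_energy.
Proof.
apply: (emeasurable_fun_cvg (fun N w => (energy N w)%:E)).
  by move=> N; apply/measurable_EFinP; exact: measurable_energy.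
move=> w _; apply/cvg_ex; eexists.
exact/ereal_nondecreasing_cvgn/nondecreasing_energy.
Qed.

Lemma energy_le_total N w : ((energy N w)%:E <= total_energy w)%E.
Proof.
apply: lime_ge.
  apply/cvg_ex; eexists; exact/ereal_nondecreasing_cvgn/nondecreasing_energy.
by near=> M; apply: nondecreasing_energy; near: M; exact: nbhs_infty_ge.
Unshelve. all: by end_near. Qed.

(** By monotone convergence the uniform bound on the mean energies passes to [total_energy], and an
    integrable function is finite almost everywhere. *)
Lemma ae_total_energy_fin : {ae P, forall w, total_energy w \is a fin_num}.
Proof.
have : P.-integrable [set: T] total_energy.
  apply/integrableP; split; first exact: measurable_total_energy.
  rewrite (eq_integral total_energy); last first.
    move=> w _; rewrite gee0_abs// (le_trans _ (energy_le_total 0 w))//.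
    by rewrite lee_fin energy_ge0.
  rewrite monotone_convergence//; last 3 first.
  - by move=> N; apply/measurable_EFinP; exact: measurable_energy.
  - by move=> N w _; rewrite lee_fin energy_ge0.
  - by move=> w _; exact: nondecreasing_energy.
  apply: (@le_lt_trans _ _ (@spectral_mass R d eta0 eta1 xi kc * 2 ^+ d)%:E); last exact: ltry.
  apply: lime_le; last by apply: nearW => N; exact: integral_energy_le.
  apply/cvg_ex; eexists; apply/ereal_nondecreasing_cvgn => N M NM.
  apply: ge0_le_integral => //.
  - by move=> w _; rewrite lee_fin energy_ge0.
  - by apply/measurable_EFinP; exact: measurable_energy.
  - by apply/measurable_EFinP; exact: measurable_energy.
  - by move=> w _; exact: nondecreasing_energy.
by move=> /(integrable_ae measurableT); apply: filterS => w; apply.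
Qed.

(* Set to 0 on the null event of infinite energy, so that the Newton series
   converges for every w. *)
Definition coefficient w (al : 'I_d -> nat) : R :=
  node_difference al w * \1_[set w | total_energy w \is a fin_num] w.

(** A single term of the energy is at most the total E, so |D^al X(0)| <= sqrt(E) 8^{-|al|} when E
    is finite; otherwise all coefficients vanish. *)
Lemma coefficient_bound w : exists K, forall al, `|coefficient w al| <= K * mpow 8^-1 al.
Proof.
have [fw|fw] := boolP (total_energy w \is a fin_num); last first.
  exists 0 => al; rewrite /coefficient indicE memNset ?mulr0 ?normr0 ?mul0r//.
  exact/negP.
exists (Num.sqrt (fine (total_energy w))) => al.
rewrite /coefficient indicE mem_set// mulr1.
have E0 : 0 <= fine (total_energy w).
  by rewrite fine_ge0// (le_trans _ (energy_le_total 0 w))// lee_fin energy_ge0.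
have E1 : node_difference al w ^+ 2 * mpow 64 al <= fine (total_energy w).
  rewrite -lee_fin fineK// (le_trans _ (energy_le_total (\sum_i al i) w))//.
  by rewrite lee_fin; apply: (box_sum_ge al (energy_term_ge0 w)).
rewrite -(@ler_pXn2r _ 2)// ?nnegrE// ?mulr_ge0 ?sqrtr_ge0 ?mpow_ge0 ?invr_ge0//.
rewrite real_normK ?num_real// exprMn sqr_sqrtr//.
rewrite [mpow 8^-1 al ^+ 2]expr2 -mpowM.
have e1 : mpow 64 al * mpow (8^-1 * 8^-1) al = 1 :> R.
  rewrite -mpowM (_ : 64 * (8^-1 * 8^-1) = 1 :> R); last by lra.
  by rewrite /mpow big1// => i _; rewrite expr1n.
rewrite -[leLHS]mulr1 -[X in _ * X <= _]e1.
by rewrite mulrA ler_wpM2r// mpow_ge0// mulr_ge0 ?invr_ge0.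
Qed.

Definition newton_field (s : 'rV[R]_d) w : R :=
  newton_series (fun l => s 0 l / mesh) (coefficient w).

Lemma measurable_newton_field s : measurable_fun [set: T] (newton_field s).
Proof.
apply: (measurable_fun_cvg (h := fun N w =>
  box_sum N (newton_term (fun l => s 0 l / mesh) (coefficient w)))).
  move=> N; apply: measurable_sum => f; apply: measurable_funM => //.
  apply: measurable_funM; first exact: measurable_lincomb.
  apply: measurable_indic; rewrite -[X in measurable X]setTI.
  exact: emeasurable_fin_num measurable_total_energy.
by move=> w _; have [K] := coefficient_bound w; exact: cvg_newton_series.
Qed.

Lemma derivable_newton_field w (s : 'rV[R]_d) i :
  derivable (fun t => newton_field t w : R) s (delta_mx 0 i).
Proof.
by have [K] := coefficient_bound w; exact: derivable_newton_series.
Qed.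

Lemma newton_field_ae_eq s : {ae P, forall w, newton_field s w = X s w}.
Proof.
pose h := mesh; pose Z N := lincomb X (newton_comb h s N ++ [:: (-1, s)]).
(* The same cut-off as in [coefficient]; with it [f N w] tends to [g w] for every w. *)
pose Om w : R := \1_[set w | total_energy w \is a fin_num] w.
have mOm : measurable_fun [set: T] Om.
  apply: measurable_indic; rewrite -[X in measurable X]setTI.
  exact: emeasurable_fin_num measurable_total_energy.
pose f N w := ((Z N w * Om w) ^+ 2)%:E.
pose g w := ((newton_field s w - X s w * Om w) ^+ 2)%:E.
have mf N : measurable_fun [set: T] (f N).
  apply/measurable_EFinP; apply: measurable_funX; apply: measurable_funM => //.
  exact: measurable_lincomb.
have mg : measurable_fun [set: T] g.
  apply/measurable_EFinP; apply: measurable_funX; apply: measurable_funB.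
    exact: measurable_newton_field.
  exact: measurable_funM.
have f0 N w : (0 <= f N w)%E by rewrite lee_fin sqr_ge0.
have fg w : f ^~ w @ \oo --> g w.
  apply: cvg_EFin; first exact: nearW.
  have [K /cvg_newton_series wK] := coefficient_bound w.
  pose F N := box_sum N (newton_term (fun l => s 0 l / h) (coefficient w)) - X s w * Om w.
  have H : F @ \oo --> newton_field s w - X s w * Om w.
    by apply: cvgB; [exact: wK|exact: cvg_cst].
  rewrite expr2 (_ : fine \o f ^~ w = F \* F); first exact: cvgM.
  apply/funext => N /=; rewrite -expr2; congr (_ ^+ 2).
  rewrite /Z lincomb_cat lincomb_newton_comb mulrDl.
  rewrite {2}/lincomb big_seq1/= mulN1r mulNr; congr (_ - _).
  rewrite /box_sum mulr_suml; apply: eq_bigr => e _.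
  by rewrite /newton_term mulrA.
have [M sM] := exists_nat_bound (fun l => s 0 l / h) 0.
pose r N : R := (1 + M.+1%:R * 2 ^+ M * 8^-1 ^+ N) ^+ d - 1.
pose V := @spectral_mass R d eta0 eta1 xi kc.
have r0 N : 0 <= r N.
  by rewrite subr_ge0 exprn_ege1// lerDl !mulr_ge0// exprn_ge0.
have fr N : (\int[P]_w f N w <= (r N ^+ 2 * V)%:E)%E.
  (* Dropping the indicator can only enlarge the square, and [Z N] is a finite combination to which
     the isometry bound applies. *)
  apply: (@le_trans _ _ (\int[P]_w (Z N w ^+ 2)%:E)%E).
    apply: ge0_le_integral => //.
      by apply/measurable_EFinP; apply: measurable_funX; exact: measurable_lincomb.
    move=> w _; rewrite lee_fin exprMn ler_piMr ?sqr_ge0// /Om indicE.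
    by case: (w \in _); rewrite ?expr1n ?expr0n.
  apply: (second_moment_lincomb_le eta00 xi0 kc0 perm HX) => // k kkc.
  apply: normc_newton_comb_error_le.
  - by rewrite gt_eqF// mesh_gt0.
  - by move=> i; exact: ball_mesh_le.
  - by move=> i; rewrite (le_trans _ (sM i))// addr0.
have cf : (fun N => \int[P]_w f N w)%E @ \oo --> 0%E.
  apply: (@squeeze_cvge _ _ _ _ (cst 0%E) _ (fun N => (r N ^+ 2 * V)%:E)).
  - by apply: nearW => N; rewrite fr integral_ge0.
  - exact: cvg_cst.
  - apply: cvg_EFin; first exact: nearW.
    have r_cvg : r @ \oo --> 0 := @cvg_newton_comb_error R d M.
    rewrite [X in _ --> X](_ : _ = 0 * 0 * V); last by rewrite !mul0r.
    by apply: cvgMl; apply: cvgM.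
(* Since [g] is the pointwise limit of the [f N], Fatou bounds its integral by the limit 0 of
   theirs. *)
have : (\int[P]_w `|g w| = 0)%E.
  rewrite (eq_integral (fun w => limn_einf (f ^~ w))); last first.
    by move=> w _; rewrite (cvg_limn_einf_sup (fg w)).1 gee0_abs// lee_fin sqr_ge0.
  apply/eqP; rewrite eq_le; apply/andP; split.
    apply: le_trans (fatou _ _ _ _) _ => //.
    by rewrite (cvg_limn_einf_sup cf).1.
  apply: integral_ge0 => w _; rewrite (cvg_limn_einf_sup (fg w)).1.
  by rewrite lee_fin sqr_ge0.
move=> /(ae_eq_integral_abs P measurableT mg).
apply: filterS2 ae_total_energy_fin => w fw /(_ Logic.I) /= /eqP.
rewrite eqe sqrf_eq0 subr_eq0 => /eqP ->.
by rewrite /Om indicE mem_set// mulr1.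
Qed.

End newton_version.

Theorem theorem3 (disp : measure_display) (T : measurableType disp)
    (R : realType) (P : probability T R) (d : nat) (eta0 eta1 xi kc : R)
    (X : 'rV[R]_d -> {RV P >-> R}) :
  (0 < d)%N -> 0 < eta0 -> 0 < xi -> 0 < kc ->
  permissible eta1 xi kc ->
  FGC_SSRF eta0 eta1 xi kc X ->
  exists2 Y : 'rV[R]_d -> {RV P >-> R}, modification Y X &
    {ae P, forall w, forall (s : 'rV[R]_d) (i : 'I_d),
      derivable (fun t : 'rV[R]_d => Y t w : R) s (delta_mx 0 i)}.
Proof.
move=> _ eta00 xi0 kc0 perm HX.
exists (fun s => mfun_Sub (mem_set (measurable_newton_field (kc := kc) (X := X) s))).
  exact: newton_field_ae_eq eta00 xi0 kc0 perm HX.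
(* Thanks to the cut-off in [coefficient], derivability holds for every w. *)
apply: aeW => w s i; exact: derivable_newton_field.
Qed.
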